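(* Consider the invariant line $[G,D]$ with viscosity ratio $0<\nu_G\le1$, and let $D_0$ be the left $f$-extension of the umbilic point $\mathcal{U}$ on $[G,D]$. Then the surface of undercompressive shocks $\mathcal{T}$ associated with the invariant plane $[G,D]\times\mathbb{R}^+$ (represented by $\mathcal{T}^-$ and $\mathcal{T}^+$, for the identity viscosity matrix) comprises the region bounded by the following curves: (1) the curves $SCB^-\subset\mathcal{T}^-$ and $SCB^+\subset\mathcal{T}^+$, connecting the points $\widehat{D}_1$ and $\widehat{\mathcal{U}}$, and $\widehat{D}$ and $\widehat{D}_0$, respectively; (2) the curves $UCB^-\subset\mathcal{T}^-$ and $UCB^+\subset\mathcal{T}^+$, connecting the points $\widehat{D}_2$ and $\widehat{\mathcal{U}}$, and $\check{D}$ and $\widehat{D}_0$, respectively; (3) the curves $GUB^-\subset\mathcal{T}^-$ and $GUB^+\subset\mathcal{T}^+$, connecting the points $\widehat{D}_2$ and $\widehat{D}_1$, and $\check{D}$ and $\widehat{D}$, respectively.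
   Context: Model. Let $\mu_w,\mu_o,\mu_g>0$. States are $U=(s_w,s_o)\in\Omega=\{s_w,s_o\ge0,\ s_w+s_o\le1\}$, $s_g=1-s_w-s_o$. The flux is $F=(f_w,f_o)$, $f_i=(s_i^2/\mu_i)/(\sum_{j\in\{w,o,g\}}s_j^2/\mu_j)$; $\lambda_s\le\lambda_f$ are the eigenvalues of $DF$. The umbilic point is $\mathcal{U}$ with $(s_w,s_o,s_g)=(\mu_w,\mu_o,\mu_g)/(\mu_w+\mu_o+\mu_g)$. Invariant line. $G$ is the vertex $s_g=1$; $\nu_G=(\mu_w+\mu_o)/\mu_g$; $[G,D]$ is the set of states with $s_w/\mu_w=s_o/\mu_o$, parametrized by $s=s_w+s_o\in[0,1]$ ($s=0$ at $G$, $s=1$ at $D$, on the edge $s_g=0$); $s_M$ is the parameter of a state $M$. One has $s_{\mathcal{U}}=\nu_G/(1+\nu_G)$. With $E(s)=s^2+\nu_G(1-s)^2$, the eigenvalues along the line are $\lambda_a=2s/E$ and $\lambda_b=2\nu_Gs(1-s)/E^2$, $\lambda_s=\min$, $\lambda_f=\max$; the Rankine-Hugoniot speed between states of the line is $\sigma(M;N)=\nu_G(s_M+s_N-2s_Ms_N)/(E(s_M)E(s_N))$ (this formula is also used when $M=N$). Shocks (viscosity matrix equal to identity). A shock from $U^-$ (left) to $U^+$ (right) with speed $\sigma$ satisfies $F(U^+)-F(U^-)=\sigma(U^+-U^-)$ and has an orbit of $\dot U=F(U)-F(U^-)-\sigma(U-U^-)$ from $U^-$ to $U^+$. It is: undercompressive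 (a $u$-shock) if $\lambda_s(U^\pm)<\sigma<\lambda_f(U^\pm)$ (saddle to saddle); a left-characteristic $s$-shock if $\lambda_s(U^+)<\sigma=\lambda_s(U^-)$ and $\sigma<\lambda_f(U^+)$; a left-characteristic $u$-shock if $\lambda_s(U^-)<\sigma=\lambda_f(U^-)$ and $\lambda_s(U^+)<\sigma<\lambda_f(U^+)$. Special states on $[G,D]$. $D_0$: $\sigma(D_0;\mathcal{U})=\lambda_s(\mathcal{U})=\lambda_f(\mathcal{U})=2$, with $s_{D_0}=1/2$. $D_1$: $\lambda_s(D_1)=\sigma(D_1;D)$ with $s_{D_1}=\nu_G/(2+\nu_G)$. $D_2$: $\lambda_f(D_2)=\sigma(D_2;D)$ with $s_{D_2}=(\sqrt{\nu_G+1}-1)/\sqrt{\nu_G+1}$. Undercompressive interval. In this case the right states are $M\in[D_0,D]$: $\mathfrak{S}(M)\in[G,\mathcal{U}]$ is the state with $\sigma(\mathfrak{S};M)=\lambda_s(\mathfrak{S})$ and $\mathcal{F}(M)\in[G,\mathcal{U}]$ is the state with $\sigma(\mathcal{F};M)=\lambda_f(\mathcal{F})$. States $U$ strictly between $\mathcal{F}(M)$ and $\mathfrak{S}(M)$ are joined to $M$ by an undercompressive shock. Write $\sigma_{\mathfrak{S}}=\sigma(\mathfrak{S}(M);M)$, $\sigma_{\mathcal{F}}=\sigma(\mathcal{F}(M);M)$. Surface. In $\Omega\times\mathbb{R}^+$ (state, speed) put $\mathcal{C}_M^-=\{(U,\sigma(U;M)):U\in[\mathcal{F}(M),\mathfrak{S}(M)]\}$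 and $\mathcal{C}_M^+=\{(M,v):\sigma_{\mathfrak{S}}\le v\le\sigma_{\mathcal{F}}\}$. The undercompressive surface $\mathcal{T}$ is represented in $(U^-,\sigma)$-coordinates by $\mathcal{T}^-=\bigcup_M\mathcal{C}_M^-$ and in $(U^+,\sigma)$-coordinates by $\mathcal{T}^+=\bigcup_M\mathcal{C}_M^+$, unions over $M\in[D_0,D]$; both lie in the plane $[G,D]\times\mathbb{R}^+$. Boundary curves (with $M\in[D_0,D]$; the superscript $-$ collects the left-state points, $+$ the right-state points; end points are included as limits). $SCB$ (slow characteristic boundary): $SCB^-=\{(\mathfrak{S},\sigma(\mathfrak{S};M))\}$, $SCB^+=\{(M,\sigma(\mathfrak{S};M))\}$ over pairs $\mathfrak{S}=\mathfrak{S}(M)$, $M$ joined by a left-characteristic $s$-shock. $UCB$ (undercompressive characteristic boundary): $UCB^-=\{(\mathcal{F},\sigma(\mathcal{F};M))\}$, $UCB^+=\{(M,\sigma(\mathcal{F};M))\}$ over pairs $\mathcal{F}=\mathcal{F}(M)$, $M$ joined by a left-characteristic $u$-shock ($\sigma=\lambda_f(\mathcal{F})$). $GUB$ (genuine undercompressive boundary): $GUB^-=\{(U,\sigma(U;D))\}$, $GUB^+=\{(D,\sigma(U;D))\}$ over $U\in(\mathcal{F}(D),\mathfrak{S}(D))$. Lifted points. $\widehat{\mathcal{U}}=(\mathcal{U},2)$; $\widehat{D}_0=(D_0,2)$; $\widehat{D}_1=(D_1,\sigma(D_1;D))$; $\widehat{D}=(D,\sigma(D_1;D))$; $\widehat{D}_2=(D_2,\sigma(D_2;D))$;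 $\check{D}=(D,\sigma(D_2;D))$. *)

(* Defs.v *)
From mathcomp Require Import all_boot all_order all_algebra.
From mathcomp Require Import all_classical all_reals all_analysis.

Set Implicit Arguments.
Unset Strict Implicit.
Unset Printing Implicit Defensive.

Import Order.TTheory GRing.Theory Num.Theory.
Import numFieldNormedType.Exports.

Local Open Scope classical_set_scope.
Local Open Scope ring_scope.

Definition simple_arc (R : realType) (T : topologicalType)
    (A : set T) (p q : T) : Prop :=
  exists g : R -> T,
    [/\ {within `[0, 1], continuous g}, set_inj `[0, 1] g,
        g 0 = p, g 1 = q & g @` `[0, 1] = A].

(* [C] is meant to be a simple closed curve in the surface [P]; its enclosed
   region consists of [C] and of the bounded components of its complement. *)
Definition enclosed_region (R : realType) (V : normedModType R)
    (P C : set V) : set V :=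
  C `|` [set x | (P `\` C) x /\ bounded_set (connected_component (P `\` C) x)].

(* The arcs [A] (from p to r), [B] (from q to r) and [C] (from q to p) meet
   only at their common end points, so that they form a simple closed curve
   in [P], and [T] is the closed region which they bound in [P]. *)
Definition region_bounded_by (R : realType) (V : normedModType R)
    (P : set V) (A B C : set V) (p q r : V) (T : set V) : Prop :=
  [/\ A `&` B = [set r], A `&` C = [set p], B `&` C = [set q],
      A `|` B `|` C `<=` P & T = enclosed_region P (A `|` B `|` C)].

Section ThreePhase.
Context {R : realType}.
Variables muw muo mug : R.

(* A state is the row vector (s_w, s_o). *)
Definition mk_state (a b : R) : 'rV[R]_2 :=
  \row_(j < 2) (if j == 0 then a else b).

Definition sat_w (U : 'rV[R]_2) : R := U 0 0.
Definition sat_o (U : 'rV[R]_2) : R := U 0 1.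
Definition sat_g (U : 'rV[R]_2) : R := 1 - sat_w U - sat_o U.

Definition Omega : set 'rV[R]_2 :=
  [set U | [/\ 0 <= sat_w U, 0 <= sat_o U & sat_w U + sat_o U <= 1]].

Definition total_mobility (U : 'rV[R]_2) : R :=
  sat_w U ^+ 2 / muw + sat_o U ^+ 2 / muo + sat_g U ^+ 2 / mug.

Definition flux (U : 'rV[R]_2) : 'rV[R]_2 :=
  mk_state (sat_w U ^+ 2 / muw / total_mobility U)
           (sat_o U ^+ 2 / muo / total_mobility U).

(* The Jacobian acts on row vectors, i.e., it is the transpose of DF, which
   has the same eigenvalues. A 2 x 2 matrix has at most two eigenvalues, so
   inf and sup are the smaller and the larger one (equal when there is only
   one). *)
Definition lambda_s (U : 'rV[R]_2) : R :=
  inf [set a | eigenvalue (jacobian flux U) a].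
Definition lambda_f (U : 'rV[R]_2) : R :=
  sup [set a | eigenvalue (jacobian flux U) a].

Definition umbilic : 'rV[R]_2 :=
  mk_state (muw / (muw + muo + mug)) (muo / (muw + muo + mug)).

Definition nuG : R := (muw + muo) / mug.

Definition line_GD : set 'rV[R]_2 :=
  [set U | Omega U /\ sat_w U / muw = sat_o U / muo].

(* The state of [line_GD] with s_w + s_o = s, for s in [0, 1]. *)
Definition state (s : R) : 'rV[R]_2 :=
  mk_state (s * (muw / (muw + muo))) (s * (muo / (muw + muo))).

Definition param (U : 'rV[R]_2) : R := sat_w U + sat_o U.

Definition sU : R := param umbilic.

Definition Eden (s : R) : R := s ^+ 2 + nuG * (1 - s) ^+ 2.

(* Rankine-Hugoniot speed between [state s] and [state t]; for s = t this
   formula is a convention. *)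
Definition sigma (s t : R) : R :=
  nuG * (s + t - 2 * s * t) / (Eden s * Eden t).

Definition shock (Ul Ur : 'rV[R]_2) (v : R) : Prop :=
  [/\ Omega Ul, Omega Ur, flux Ur - flux Ul = v *: (Ur - Ul) &
      exists phi : R -> 'rV[R]_2,
        [/\ forall t, Omega (phi t),
            forall t : R, is_derive (t : R^o) 1 phi
              (flux (phi t) - flux Ul - v *: (phi t - Ul)),
            phi t @[t --> -oo] --> Ul & phi t @[t --> +oo] --> Ur]].

Definition left_char_s_shock (Ul Ur : 'rV[R]_2) (v : R) : Prop :=
  [/\ shock Ul Ur v, lambda_s Ur < v, v = lambda_s Ul & v < lambda_f Ur].

Definition left_char_u_shock (Ul Ur : 'rV[R]_2) (v : R) : Prop :=
  [/\ shock Ul Ur v, lambda_s Ul < v, v = lambda_f Ul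
    & lambda_s Ur < v < lambda_f Ur].

(* [state s] is the left f-extension of [state n] on the line. As
   [sigma n n] is a characteristic speed, s = n may solve the equation
   without being an extension: it is retained only if there is no other
   solution. For the umbilic point this yields s = 1/2. *)
Definition left_f_extension (n s : R) : Prop :=
  [/\ 0 <= s <= 1, sigma s n = lambda_f (state n) &
      forall t, 0 <= t <= 1 -> sigma t n = lambda_f (state n) ->
        t != n -> t = s].

Definition sD1 : R := nuG / (2 + nuG).
Definition sD2 : R := (Num.sqrt (nuG + 1) - 1) / Num.sqrt (nuG + 1).

(* Parameters of the states S(M) and F(M) of [G, U], where m = s_M. *)
Definition frakS (m : R) : R :=
  get [set s | 0 <= s <= sU /\ sigma s m = lambda_s (state s)].
Definition calF (m : R) : R :=
  get [set s | 0 <= s <= sU /\ sigma s m = lambda_f (state s)].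

Definition plane_GD : set ('rV[R]_2 * R) :=
  [set x | line_GD x.1 /\ 0 < x.2].

Definition Cminus (m : R) : set ('rV[R]_2 * R) :=
  [set (state s, sigma s m) | s in `[calF m, frakS m]].
Definition Cplus (m : R) : set ('rV[R]_2 * R) :=
  [set (state m, v) | v in `[sigma (frakS m) m, sigma (calF m) m]].

(* From here on, sD0 is the parameter of D_0, and D has parameter 1. *)
Definition Tminus (sD0 : R) : set ('rV[R]_2 * R) :=
  \bigcup_(m in `[sD0, 1]) Cminus m.
Definition Tplus (sD0 : R) : set ('rV[R]_2 * R) :=
  \bigcup_(m in `[sD0, 1]) Cplus m.

Definition SCB_dom (sD0 : R) : set R :=
  [set m | sD0 <= m <= 1 /\
    left_char_s_shock (state (frakS m)) (state m) (sigma (frakS m) m)].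
Definition UCB_dom (sD0 : R) : set R :=
  [set m | sD0 <= m <= 1 /\
    left_char_u_shock (state (calF m)) (state m) (sigma (calF m) m)].
Definition GUB_dom : set R := `]calF 1, frakS 1[.

(* The closures add the end points of the curves as limits; for instance, at
   M = D_0 the left state is the umbilic point, which is not strictly
   hyperbolic. *)
Definition SCBminus (sD0 : R) : set ('rV[R]_2 * R) :=
  closure [set (state (frakS m), sigma (frakS m) m) | m in SCB_dom sD0].
Definition SCBplus (sD0 : R) : set ('rV[R]_2 * R) :=
  closure [set (state m, sigma (frakS m) m) | m in SCB_dom sD0].

Definition UCBminus (sD0 : R) : set ('rV[R]_2 * R) :=
  closure [set (state (calF m), sigma (calF m) m) | m in UCB_dom sD0].
Definition UCBplus (sD0 : R) : set ('rV[R]_2 * R) :=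
  closure [set (state m, sigma (calF m) m) | m in UCB_dom sD0].

Definition GUBminus : set ('rV[R]_2 * R) :=
  closure [set (state s, sigma s 1) | s in GUB_dom].
Definition GUBplus : set ('rV[R]_2 * R) :=
  closure [set (state 1, sigma s 1) | s in GUB_dom].

Definition hatU : 'rV[R]_2 * R := (umbilic, 2).
Definition hatD0 (sD0 : R) : 'rV[R]_2 * R := (state sD0, 2).
Definition hatD1 : 'rV[R]_2 * R := (state sD1, sigma sD1 1).
Definition hatD : 'rV[R]_2 * R := (state 1, sigma sD1 1).
Definition hatD2 : 'rV[R]_2 * R := (state sD2, sigma sD2 1).
Definition checkD : 'rV[R]_2 * R := (state 1, sigma sD2 1).

End ThreePhase.

(* Main.v *)
From HB Require Import structures.
Require Import Defs.
From mathcomp Require Import all_boot all_order all_algebra.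
From mathcomp Require Import all_classical all_reals all_analysis.
From mathcomp Require Import ring lra.

Import Order.TTheory GRing.Theory Num.Theory.
Import numFieldNormedType.Exports.
Local Open Scope classical_set_scope.
Local Open Scope ring_scope.

(** The flow on the invariant line is that of one scalar conservation law, and
everything on it is explicit. For a left state of parameter s and a right state
of parameter m, polynomial identities compare the speed [sigma s m] with the
two characteristic speeds [lam_a] and [lam_b] at s: the sign of [sigma s m -
lam_a s] is that of [nu * m - s * denS m], and the sign of [lam_b s - sigma s
m] is that of [(m - s) * tang s m]. Hence the states S(M) and F(M) have the
closed forms [fS] and [fF], which depend continuously on m, and for s in [G,U]
and m in [D_0,D] the condition F(M) <= s <= S(M) says exactly that [sigma s m]
lies between [lam_a s] and [lam_b s].

In left states the surface therefore consists of the points (s, v) with [sigma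
s 1 <= v] and [lam_a s <= v <= lam_b s]: a right state realizing a given v is
found by the intermediate value theorem in m, because [sigma s (1/2) >= lam_b
s] ([region_minusP]). The curves GUB, SCB and UCB are the places where the
first, the second or the third inequality is an equality. In right states the
surface is the set of (m, v) with m in [1/2, 1] and v between the two speeds
[speedS m] and [speedF m], and the three curves are again given by equality in
the inequalities.

Both regions are thus sets [h >= 0] for a continuous function h on the plane,
with boundary curves [h = 0]. The set [h > 0] is open and closed in the
complement of the curves, so its components stay in a bounded set; a point with
[h < 0] can be moved to infinity, either straight up, or down to a small speed,
then along that speed to the vertex G, then up ([enclosed_region_superlevel],
[unbounded_component]).

The curves are defined through shocks, so the shocks have to be produced. The
Jacobian at a state of the line has the eigenvalues [lam_a] (eigenvector
transversal to the line) and [lam_b] (along the line), ordered by the side of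
the umbilic point ([eigenvalues_state]). On the line the travelling wave
equation is s' = (s - l) (m - s) Z(s) with Z > 0 between l and m, and such an
equation has an orbit from l to m ([heteroclinic_orbit]); the right-hand side
may vanish to second order at l, as it does for l = F(M). So every m in ]1/2,
1] occurs in SCB and in UCB, and the closures are images of the compact
interval [1/2, 1]. The remaining ingredient is that D_0 has parameter 1/2: the
only solutions s of [sigma s umb = 2] are s = umb and s = 1/2. *)

Set Implicit Arguments.
Unset Strict Implicit.
Unset Printing Implicit Defensive.

(** * Arcs and enclosed regions *)

Section Curves.
Context {R : realType}.

(** The image of the closed interval is compact, hence closed, and the image
of the open one is dense in it. *)
Lemma closure_image_itv (V : normedModType R) (g : R -> V) (a b : R)
    (D : set R) : a < b -> continuous g -> `]a, b[ `<=` D -> D `<=` `[a, b] ->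
  closure (g @` D) = g @` `[a, b].
Proof.
move=> ab cg oD Dc; apply/seteqP; split.
  have cl : closed (g @` `[a, b]).
    apply: compact_closed; first exact: norm_hausdorff.
    apply: continuous_compact; last exact: segment_compact.
    exact: continuous_subspaceT.
  rewrite [X in _ `<=` X](closure_id _).1 //.
  by apply: closureS; apply: image_subset.
move=> _ [x /= xab <-] B nB.
pose c := (a + b) / 2.
have cx : x + t * (c - x) @[t --> 0^'+] --> x.
  rewrite [X in _ --> X](_ : x = x + 0 * (c - x)); last by rewrite mul0r addr0.
  apply: cvgD; first exact: cvg_cst.
  by apply: cvgM; [exact: cvg_at_right_filter|exact: cvg_cst].
have nBg : \forall t \near 0^'+, B (g (x + t * (c - x))) := cx _ (cg _ _ nB).
have [t [t0 t1 Bt]] : exists t, [/\ 0 < t, t < 1 & B (g (x + t * (c - x)))].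
  near (0 : R)^'+ => t; exists t; split; first by [].
  - by near: t; exact: nbhs_right_lt.
  - by near: t.
exists (g (x + t * (c - x))); split => //; exists (x + t * (c - x)) => //.
apply: oD; move: xab; rewrite /= !in_itv /= /c => /andP[ax xb].
by apply/andP; split; nra.
Unshelve. all: by end_near. Qed.

(** Both orientations are given: the boundary curves are run through against
their natural parameter. *)
Lemma simple_arc_image (T : topologicalType) (g : R -> T) (a b : R) :
  a < b -> continuous g -> set_inj `[a, b] g ->
  simple_arc R (g @` `[a, b]) (g a) (g b) /\
  simple_arc R (g @` `[a, b]) (g b) (g a).
Proof.
move=> ab cg ig.
suff H (p q : R) : p != q ->
    `[a, b]%classic = [set p + t * (q - p) | t in `[0, 1]] ->
    simple_arc R (g @` `[a, b]) (g p) (g q).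
  split; apply: H; rewrite ?(lt_eqF ab) ?(gt_eqF ab) //;
    apply/seteqP; split => x /=.
  - rewrite in_itv /= => /andP[ax xb]; exists ((x - a) / (b - a)); last first.
      by field; lra.
    by rewrite in_itv /= ler_pdivlMr ?ler_pdivrMr ?subr_gt0 //; lra.
  - by move=> [t]; rewrite !in_itv /= => /andP[? ?] <-; nra.
  - rewrite in_itv /= => /andP[ax xb]; exists ((b - x) / (b - a)); last first.
      by field; lra.
    by rewrite in_itv /= ler_pdivlMr ?ler_pdivrMr ?subr_gt0 //; lra.
  - by move=> [t]; rewrite !in_itv /= => /andP[? ?] <-; nra.
move=> pq abE; exists (fun t => g (p + t * (q - p))); split.
- apply: continuous_subspaceT => t; apply: continuous_comp; last exact: cg.
  apply: continuousD; first exact: cst_continuous.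
  by apply: continuousM => //; exact: cst_continuous.
- move=> s t; rewrite !inE => s01 t01 /ig; rewrite !inE.
  rewrite abE => H; have /addrI : p + s * (q - p) = p + t * (q - p).
    by apply: H; [exists s|exists t].
  by apply: mulIf; rewrite subr_eq0 eq_sym.
- by rewrite mul0r addr0.
- by rewrite mul1r subrKC.
- by rewrite abE -image_comp.
Qed.

Lemma continuous_minr (T : topologicalType) (f g : T -> R) :
  continuous f -> continuous g -> continuous (fun x => Num.min (f x) (g x)).
Proof. by move=> cf cg x; exact: (continuous_min (cf x) (cg x)). Qed.

Lemma continuous_subr (T : topologicalType) (f g : T -> R) :
  continuous f -> continuous g -> continuous (fun x => f x - g x).
Proof. by move=> cf cg x; apply: cvgB; [exact: cf|exact: cg]. Qed.

(** A connected set that avoids [h = 0] and meets [h > 0] stays in [h > 0],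
since there [h > 0] and [h >= 0] are the same condition, one open and one
closed. *)
Lemma enclosed_region_superlevel (V : normedModType R) (P : set V)
    (h : V -> R) : continuous h -> bounded_set (P `&` [set x | 0 <= h x]) ->
  (forall x, P x -> h x < 0 ->
     ~ bounded_set (connected_component (P `&` [set y | h y < 0]) x)) ->
  enclosed_region P (P `&` [set x | h x = 0]) = P `&` [set x | 0 <= h x].
Proof.
move=> ch bT esc; set C := P `&` [set x | h x = 0].
have PCE x : (P `\` C) x <-> P x /\ h x != 0.
  split=> [[Px nCx]|[Px /eqP hx]]; last by split => // -[].
  by split => //; apply/eqP => hx; apply: nCx.
have bndS (A B : set V) : A `<=` B -> bounded_set B -> bounded_set A.
  move=> AB [M [Mr HM]]; exists M; split=> // N MN x /AB; exact: HM.
apply/seteqP; split=> x.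
- case=> [[Px hx]|[/PCE[Px hx] bx]]; first by split => //; rewrite /= hx.
  split => //=; rewrite leNgt; apply/negP => hx0; apply: (esc x) => //.
  apply: bndS bx => y [K [Kx KS cK] Ky]; exists K => //; split => //.
  by move=> z /KS[Pz /= hz]; apply/PCE; split; rewrite ?lt_eqF.
- move=> [Px /= hx0]; have [hx|hx] := eqVneq (h x) 0; first by left.
  right; split; first exact/PCE.
  apply: bndS bT => y [K [Kx KS cK] Ky].
  have KE z : K z -> (0 < h z) = (0 <= h z).
    by move=> /KS/PCE[_ hz]; rewrite lt0r hz.
  have : K `&` [set z | 0 < h z] = K.
    apply: cK.
    - by exists x; split => //=; rewrite KE.
    - exists (h @^-1` [set t | 0 < t]) => //.
      by move/continuousP : ch; apply; exact: open_gt.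
    - exists (h @^-1` [set t | 0 <= t]).
        by move/continuous_closedP : ch; apply; exact: closed_ge.
      by apply/seteqP; split => z [Kz /=]; rewrite KE.
  move=> /seteqP[_ /(_ _ Ky)[_ /= hy]].
  by split; [have /PCE[] := KS _ Ky|exact: ltW].
Qed.

(** [N] is meant to be the part of the strip [0, 1] x ]0, +oo[ outside a
closed curve: it contains the edge s = 0 and all speeds up to [c], so that a
point from which one can go straight down also reaches infinity, along the
bottom and then up the edge. *)
Lemma unbounded_component (V : normedModType R) (w : R -> R -> V)
    (P N : set V) (c : R) :
  (forall s, continuous (w s)) -> (forall v, continuous (w^~ v)) ->
  (forall s v, 0 <= s <= 1 -> 0 < v -> v <= `|w s v|) ->
  0 < c ->
  (forall v, 0 < v -> N (w 0 v)) ->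
  (forall s v, 0 <= s <= 1 -> 0 < v <= c -> N (w s v)) ->
  forall s v, 0 <= s <= 1 -> 0 < v -> N (w s v) ->
    (forall t, v <= t -> N (w s t)) \/ (forall t, 0 < t <= v -> N (w s t)) ->
  ~ bounded_set (connected_component N (w s v)).
Proof.
move=> cwv cws wn c0 N0 Nc s v s01 v0 Nsv updown bN.
have /andP[s0 s1] := s01.
have vert s' a b : a <= b -> (forall t, a <= t <= b -> N (w s' t)) ->
    connected_component N (w s' a) (w s' b).
  move=> ab Nab; exists (w s' @` `[a, b]); last first.
    by exists b => //=; rewrite in_itv /= ab lexx.
  split; first by exists a => //=; rewrite in_itv /= ab lexx.
    by move=> _ [t /= tab <-]; apply: Nab; rewrite in_itv in tab.
  apply: connected_continuous_connected; first exact: segment_connected.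
  exact/continuous_subspaceT/cwv.
suff [s' [t0 [s'01 t00 H]]] : exists s' t0, [/\ 0 <= s' <= 1, 0 < t0 &
    forall t, t0 <= t -> connected_component N (w s v) (w s' t)].
  have [M HM] := filter_ex (bN : \forall M \near +oo, _).
  pose t := Num.max t0 (M + 1).
  have tt0 : t0 <= t by rewrite le_max lexx.
  have /= := HM _ (H t tt0); apply/negP; rewrite -ltNge.
  apply: lt_le_trans (wn _ _ s'01 (lt_le_trans t00 tt0)).
  by rewrite lt_max; apply/orP; right; lra.
case: updown => [up|down].
  exists s, v; split => // t vt; apply: vert => // t' /andP[? ?].
  exact: up.
pose e := Num.min v c.
have e0 : 0 < e by rewrite lt_min v0.
have ev : e <= v by rewrite ge_min lexx.
have ec : e <= c by rewrite ge_min lexx orbT.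
exists 0, e; split; rewrite ?lexx ?ler01 // => t et.
have C1 : connected_component N (w s v) (w s e).
  apply: connected_component_sym; apply: vert => // t' /andP[? ?].
  by apply: down; apply/andP; split => //; exact: lt_le_trans e0 _.
have C2 : connected_component N (w s e) (w 0 e).
  exists (w^~ e @` `[0, s]); last first.
    by exists 0 => //=; rewrite in_itv /= s0 lexx.
  split; first by exists s => //=; rewrite in_itv /= s0 lexx.
    move=> _ [t' /= + <-]; rewrite in_itv /= => /andP[t'0 t's]; apply: Nc.
      by rewrite t'0 (le_trans t's).
    by rewrite e0.
  apply: connected_continuous_connected; first exact: segment_connected.
  exact/continuous_subspaceT/cws.
apply: connected_component_trans C1 _; apply: connected_component_trans C2 _.
apply: vert => // t' /andP[et' _]; apply: N0; exact: lt_le_trans et'.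
Qed.

End Curves.

(** * Heteroclinic orbits of scalar equations *)

Section Orbit.
Context {R : realType}.
Implicit Types h Z : R -> R.
Local Notation mu := (@lebesgue_measure R).

(** An integral with a fixed base point only gives a primitive to the right of
that point. Here the base point moves to the left with x, and the integral
from it to 0 is subtracted to make the value independent of its choice. *)
Lemma continuous_antiderivative h : continuous h ->
  exists H : R -> R, forall x : R, is_derive x 1 H (h x).
Proof.
move=> ch.
have ih (a b : R) : mu.-integrable `[a, b] (EFin \o h).
  apply: continuous_compact_integrable; first exact: segment_compact.
  exact: continuous_subspaceT.
pose I (a b : R) := (\int[mu]_(t in `[a, b]) h t)%R.
have IB (a b c : R) : a <= b -> b <= c -> I a c - I a b = I b c.
  move=> ab bc; rewrite /I Rintegral_itvB ?bnd_simp //.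
  rewrite Rintegral_itv_obnd_cbnd //.
  apply: integrableS (ih b c) => //.
  by apply: subset_itvr; rewrite bnd_simp.
(* Both x and 0 lie to the right of the base point. *)
pose H x := I (- (`|x| + 1)) x - I (- (`|x| + 1)) 0.
exists H => x0; pose N := `|x0| + 2.
have HN : \forall x \near x0, I (- N) x - I (- N) 0 = H x.
  near=> x.
  have xN : `|x| + 1 <= N.
    rewrite /N -[2]/(1 + 1) addrA lerD2r.
    have := ler_normD x0 (x - x0); rewrite subrKC => /le_trans; apply.
    rewrite lerD2l distrC ltW //; near: x.
  have aN : - N <= - (`|x| + 1) by rewrite lerN2.
  have := ler_norm x; have := ler_norm (- x); rewrite normrN => xa1 xa2.
  rewrite /H -(IB _ _ x aN) -?(IB _ _ 0 aN); [ring|lra..].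
apply: near_eq_is_derive HN _.
rewrite -[h x0]subr0; apply: is_deriveB.
have xx : x0 < x0 + 1 by lra.
have Nx : - N < x0.
  have := ler_norm (- x0); rewrite normrN /N; lra.
have [dI dIE] := continuous_FTC1_closed xx (ih (- N) _) Nx (ch x0).
by apply: DeriveDef; [exact: dI|rewrite -derive1E].
Unshelve. all: by end_near. Qed.

(** The solution of y' = y (1 - y) with y(0) = 1/2. *)
Let logistic (x : R) : R := (1 + expR (- x))^-1.

Let logistic_itv x : 0 < logistic x < 1.
Proof.
have e0 := expR_gt0 (- x); rewrite /logistic invr_gt0 invf_lt1; lra.
Qed.

Let logisticN x : logistic (- x) = 1 - logistic x.
Proof.
rewrite /logistic opprK expRN; have e0 := expR_gt0 x; field; lra.
Qed.

Let is_derive_logistic (x : R) :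
  is_derive x 1 logistic (logistic x * (1 - logistic x)).
Proof.
have e0 := expR_gt0 (- x).
have d1 : is_derive x 1 (fun y : R => 1 + expR (- y)) (0 + expR (- x) * - 1).
  by apply: is_deriveD; exact: is_derive1_comp.
have e1 : 1 + expR (- x) != 0 by rewrite gt_eqF //; lra.
suff -> : logistic x * (1 - logistic x) =
    - (1 + expR (- x)) ^- 2 *: (0 + expR (- x) * - 1).
  exact: (@is_deriveV _ (fun y => 1 + expR (- y)) _ _ _ e1 d1).
rewrite /GRing.scale /= /logistic; field; lra.
Qed.

Let logistic_cvgy : logistic x @[x --> +oo] --> (1 : R).
Proof.
rewrite [X in _ --> X](_ : 1 = (1 + 0)^-1); last by rewrite addr0 invr1.
apply: cvgV; first by rewrite addr0 oner_neq0.
by apply: cvgD; [exact: cvg_cst|exact: cvgr_expR].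
Qed.

Let logistic_cvgNy : logistic x @[x --> -oo] --> (0 : R).
Proof.
apply/cvgNy_compNP.
suff: (logistic \o -%R) x @[x --> +oo] --> (1 - 1 : R) by rewrite subrr.
under eq_cvg do rewrite /= logisticN.
by apply: cvgB; [exact: cvg_cst|exact: logistic_cvgy].
Qed.

(** K is the inverse of a primitive of h; the lower bound [c] makes this
primitive strictly increasing from -oo to +oo. *)
Lemma logistic_time_change h (c : R) : continuous h -> 0 < c ->
  (forall x, c <= h x) ->
  exists K : R -> R, [/\ forall t : R, is_derive t 1 K (h (K t))^-1,
    K t @[t --> +oo] --> +oo & K t @[t --> -oo] --> -oo].
Proof.
move=> ch c0 hc; have [H dH] := continuous_antiderivative ch.
have cH : continuous H.
  move=> x; apply: differentiable_continuous; apply/derivable1_diffP.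
  by case: (dH x).
have growth x y : x <= y -> c * (y - x) <= H y - H x.
  move=> xy; have [z _ ->] := @MVT_segment _ H h x y xy (fun z _ => dH z)
    (continuous_subspaceT cH).
  by rewrite ler_wpM2r // subr_ge0.
have Hlt x y : x < y -> H x < H y.
  move=> xy; rewrite -subr_gt0; apply: lt_le_trans (growth _ _ (ltW xy)).
  by rewrite mulr_gt0 // subr_gt0.
have Hle x y : H x <= H y -> x <= y.
  by move=> Hxy; rewrite leNgt; apply/negP => /Hlt; rewrite ltNge Hxy.
have surj t : exists x, H x = t.
  pose y := `|t - H 0| / c.
  have y0 : 0 <= y by rewrite divr_ge0 // ltW.
  have cy : c * y = `|t - H 0| by rewrite mulrC divfK // gt_eqF.
  have := growth _ _ y0; have := growth (- y) 0; rewrite oppr_le0 => /(_ y0).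
  rewrite sub0r opprK subr0 cy => H1 H2.
  have := ler_norm (t - H 0); have := ler_norm (- (t - H 0)).
  rewrite normrN => H3 H4.
  have yy : - y <= y by lra.
  have [||x _ <-] := @IVT _ H (- y) y t yy.
  - exact: continuous_subspaceT.
  - by rewrite ge_min le_max; apply/andP; split; apply/orP; [left|right]; lra.
  by exists x.
have [K HK] := choice surj.
have KH : cancel H K.
  by move=> x; apply/eqP; rewrite eq_le; apply/andP; split; apply: Hle;
    rewrite HK.
exists K; split.
- move=> t; have := @is_derive_inverse _ H K (h (K t)) (K t).
  rewrite HK; apply.
  + by near=> x; exact: KH.
  + by near=> x; exact: cH.
  + by rewrite gt_eqF // (lt_le_trans c0).
- apply/cvgryPgt => A; near=> t; rewrite ltNge; apply/negP => KA.
  have : H A < t by near: t; exact: nbhs_pinfty_gt (num_real _).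
  rewrite -(HK t) ltNge; move: KA; rewrite le_eqVlt.
  by case/predU1P => [->|/Hlt/ltW ->]; rewrite ?lexx.
- apply/cvgrNyPlt => A; near=> t; rewrite ltNge; apply/negP => KA.
  have : t < H A by near: t; exact: nbhs_ninfty_lt (num_real _).
  rewrite -(HK t) ltNge; move: KA; rewrite le_eqVlt.
  by case/predU1P => [->|/Hlt/ltW ->]; rewrite ?lexx.
Unshelve. all: by end_near. Qed.

(** The equation x' = (x - l) (m - x) is solved by a logistic curve L. Running
L along a time change K with K' = (m - l) Z(L(K)) gives the equation with the
factor Z. The derivative of the inverse time change is bounded below because Z
is bounded above on [l, m], also when Z vanishes at an end point. *)
Lemma heteroclinic_orbit Z (l m : R) : l < m -> continuous Z ->
  (forall s, l < s < m -> 0 < Z s) ->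
  exists phi : R -> R, [/\ forall t, l < phi t < m,
    forall t : R, is_derive t 1 phi ((phi t - l) * (m - phi t) * Z (phi t)),
    phi t @[t --> -oo] --> l & phi t @[t --> +oo] --> m].
Proof.
move=> lm cZ Z0; pose L x := l + (m - l) * logistic x.
have ml : 0 < m - l by rewrite subr_gt0.
have Llm x : l < L x < m.
  by have /andP[? ?] := logistic_itv x; apply/andP; split; rewrite /L; nra.
have dL (x : R) : is_derive x 1 L ((m - l) * (logistic x * (1 - logistic x))).
  rewrite -[X in is_derive _ _ _ X]add0r; apply: is_deriveD.
  exact: (@is_deriveZ _ _ _ logistic (m - l)).
have cL : continuous L.
  move=> x; apply: differentiable_continuous; apply/derivable1_diffP.
  by case: (dL x).
pose h x := ((m - l) * Z (L x))^-1.
have [M Mlm Mmax] := @EVT_max _ Z l m (ltW lm) (continuous_subspaceT cZ).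
have LM x : Z (L x) <= Z M.
  by apply: Mmax; have /andP[? ?] := Llm x; rewrite in_itv /= !ltW.
have M0 : 0 < Z M by apply: lt_le_trans (LM 0); apply: Z0; exact: Llm.
have [K [dK Ky KNy]] : exists K : R -> R, [/\
    forall t : R, is_derive t 1 K (h (K t))^-1,
    K t @[t --> +oo] --> +oo & K t @[t --> -oo] --> -oo].
  apply: (@logistic_time_change h ((m - l) * Z M)^-1).
  - move=> x; apply: cvgV.
      by rewrite mulf_neq0 ?gt_eqF // Z0.
    apply: cvgM; first exact: cvg_cst.
    by apply: continuous_comp; [exact: cL|exact: cZ].
  - by rewrite invr_gt0 mulr_gt0.
  - move=> x; rewrite lef_pV2 ?posrE ?(mulr_gt0 ml) //; last exact: Z0.
    by rewrite ler_wpM2l // ltW.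
exists (L \o K); split => [t|t||] /=; first exact: Llm.
- have -> : (L (K t) - l) * (m - L (K t)) * Z (L (K t)) =
    (m - l) * (logistic (K t) * (1 - logistic (K t))) * (h (K t))^-1.
    by rewrite /h invrK /L; ring.
  exact: is_derive1_comp.
- apply: cvg_comp KNy _; have -> : l = l + (m - l) * 0 by ring.
  apply: cvgD; first exact: cvg_cst.
  by apply: cvgM; [exact: cvg_cst|exact: logistic_cvgNy].
- apply: cvg_comp Ky _; have -> : m = l + (m - l) * 1 by ring.
  apply: cvgD; first exact: cvg_cst.
  by apply: cvgM; [exact: cvg_cst|exact: logistic_cvgy].
Unshelve. all: by end_near. Qed.

End Orbit.

(** * Speeds along the invariant line *)

Section LineAlgebra.
Context {R : realType}.
Variables muw muo mug : R.
Implicit Types l m n s t : R.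
Local Notation nu := (nuG muw muo mug).
Local Notation E := (Eden muw muo mug).
Local Notation sg := (sigma muw muo mug).
Hypothesis nu0 : 0 < nu.

(** The eigenvalue whose eigenvector is transversal to the line. *)
Definition lam_a (s : R) : R := 2 * s / E s.
(** The eigenvalue along the line, which is the derivative of s^2 / E(s). *)
Definition lam_b (s : R) : R := 2 * nu * s * (1 - s) / E s ^+ 2.
(** The equation [sigma s m = lam_b s], saying that the chord of s^2 / E(s)
from s to m is tangent at s, is a cubic in s with the root m. This is the
quadratic that is left. *)
Definition tang (s m : R) : R :=
  (1 + nu) * (1 - 2 * m) * s ^+ 2 + 2 * (1 + nu) * m * s - nu.
Definition denS (m : R) : R := 2 * (1 + nu) * m ^+ 2 - 2 * nu * m + nu.
(** Closed forms of the parameters of S(M) and F(M). The second is the root of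
[tang] written with the square root in the denominator, so that the vanishing
of the leading coefficient at m = 1/2 is harmless. *)
Definition fS (m : R) : R := nu * m / denS m.
Definition fF (m : R) : R := nu / ((1 + nu) * m + Num.sqrt ((1 + nu) * E m)).
Definition umb : R := nu / (1 + nu).

Lemma Eden_gt0 s : 0 < E s.
Proof.
have k0 : 0 < 1 + nu by rewrite ltr_wpDl.
rewrite -(pmulr_rgt0 _ k0) /Eden.
have -> : (1 + nu) * (s ^+ 2 + nu * (1 - s) ^+ 2) =
  ((1 + nu) * s - nu) ^+ 2 + nu by ring.
by rewrite ltr_wpDl // sqr_ge0.
Qed.

Let k0 : 0 < 1 + nu. Proof. by rewrite ltr_wpDl. Qed.

Local Ltac lra_nu := have := nu0; lra.

Let Enz s : E s != 0. Proof. by rewrite gt_eqF // Eden_gt0. Qed.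

Lemma denS_gt0 m : 0 < denS m.
Proof.
have k2 : 0 < 2 * (1 + nu) by rewrite mulr_gt0.
rewrite -(pmulr_rgt0 _ k2) /denS.
have -> : 2 * (1 + nu) * (2 * (1 + nu) * m ^+ 2 - 2 * nu * m + nu) =
  (2 * (1 + nu) * m - nu) ^+ 2 + nu * (2 + nu) by ring.
by rewrite ltr_wpDl ?sqr_ge0 // mulr_gt0 // ltr_wpDl.
Qed.

Lemma sigmaC s m : sg s m = sg m s.
Proof. by rewrite /sigma [E s * _]mulrC; congr (_ / _); ring. Qed.

Lemma sigma_sub_lam_a s m :
  sg s m - lam_a s = (nu * m - s * denS m) / (E s * E m).
Proof.
rewrite /sigma /lam_a (_ : denS m = 2 * E m - nu + 2 * nu * m); last first.
  by rewrite /denS /Eden; ring.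
by field; rewrite !Enz.
Qed.

Lemma lam_b_sub_sigma s m :
  lam_b s - sg s m = nu * (m - s) * tang s m / (E s ^+ 2 * E m).
Proof.
have -> : nu * (m - s) * tang s m =
    nu * (2 * s * (1 - s) * E m - (s + m - 2 * s * m) * E s).
  by rewrite /tang /Eden; ring.
by rewrite /sigma /lam_b; field; rewrite !Enz.
Qed.

Lemma lam_b_sub_lam_a s :
  lam_b s - lam_a s = 2 * s ^+ 2 * (nu - (1 + nu) * s) / E s ^+ 2.
Proof.
have -> : 2 * s ^+ 2 * (nu - (1 + nu) * s) =
    2 * nu * s * (1 - s) - 2 * s * E s by rewrite /Eden; ring.
by rewrite /lam_a /lam_b; field; rewrite !Enz.
Qed.

(** The numerator is also that of the right-hand side of the travelling wave
equation from l to m, up to the factor m - s. *)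
Lemma sigma_sub_sigma l s m : sg l m - sg s m =
  nu * (s - l) * (tang l m + (l + m - 2 * l * m) * (1 + nu) * (s - l)) /
  (E l * E s * E m).
Proof.
have -> : nu * (s - l) *
    (tang l m + (l + m - 2 * l * m) * (1 + nu) * (s - l)) =
    nu * ((l + m - 2 * l * m) * E s - (s + m - 2 * s * m) * E l).
  by rewrite /tang /Eden; ring.
by rewrite /sigma; field; rewrite !Enz.
Qed.

Lemma lam_a_le_sigma s m : (lam_a s <= sg s m) = (s <= fS m).
Proof.
rewrite -subr_ge0 sigma_sub_lam_a pmulr_lge0 ?invr_gt0 ?mulr_gt0 ?Eden_gt0 //.
by rewrite subr_ge0 /fS ler_pdivlMr ?denS_gt0.
Qed.

Lemma lam_a_eq_sigma s m : (sg s m == lam_a s) = (s == fS m).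
Proof.
rewrite -subr_eq0 sigma_sub_lam_a mulf_eq0 invr_eq0 mulf_eq0 !(negbTE (Enz _)).
have d0 : denS m != 0 by rewrite gt_eqF ?denS_gt0.
rewrite !orbF subr_eq0; apply/eqP/eqP => [h|->]; first by rewrite /fS h mulfK.
by rewrite divfK.
Qed.

Lemma sigma_le_lam_b s m : s < m -> (sg s m <= lam_b s) = (0 <= tang s m).
Proof.
move=> sm; rewrite -subr_ge0 lam_b_sub_sigma.
rewrite pmulr_lge0 ?invr_gt0 ?mulr_gt0 ?exprn_gt0 ?Eden_gt0 //.
by rewrite pmulr_rge0 // mulr_gt0 // subr_gt0.
Qed.

Lemma lam_a_le_lam_b s : 0 < s -> (lam_a s <= lam_b s) = (s <= umb).
Proof.
move=> s0; rewrite -subr_ge0 lam_b_sub_lam_a.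
rewrite pmulr_lge0 ?invr_gt0 ?exprn_gt0 ?Eden_gt0 //.
rewrite pmulr_rge0 ?mulr_gt0 ?exprn_gt0 // subr_ge0.
by rewrite /umb [RHS]ler_pdivlMr // [s * _]mulrC.
Qed.

(** Tangency at s forces [tang m s > 0] for s < m: this gives the speed
condition at the right state. *)
Lemma tangC s m :
  tang m s - tang s m = (1 + nu) * (m - s) * (m + s - 2 * s * m).
Proof. by rewrite /tang; ring. Qed.

Lemma tang_incr s t m : 0 <= s -> t < 1 -> 2^-1 <= m <= 1 -> s < t ->
  tang s m < tang t m.
Proof.
move=> s0 t1 /andP[m0 m1] st; rewrite -subr_gt0.
have -> : tang t m - tang s m =
  (1 + nu) * ((t - s) * ((t + s) * (1 - m) + m * (2 - (t + s)))).
  by rewrite /tang; ring.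
rewrite mulr_gt0 ?k0 // mulr_gt0 ?subr_gt0 //.
by apply: ltr_wpDl; [apply: mulr_ge0|apply: mulr_gt0]; lra_nu.
Qed.

(** (1 + nu) E(m) exceeds the square of nu - (1 + nu) m by exactly nu. The
denominator of [fF] is therefore positive for every real m. *)
Lemma sqrt_gt_line m : nu - (1 + nu) * m < Num.sqrt ((1 + nu) * E m).
Proof.
apply: le_lt_trans (ler_norm _) _.
rewrite -sqrtr_sqr ltr_sqrt; last first.
  by rewrite mulr_gt0 ?Eden_gt0 // k0.
rewrite -subr_gt0 (_ : _ - _ = nu) // /Eden; ring.
Qed.

Lemma fF_gt0 m : 0 < fF m.
Proof.
rewrite /fF; apply: divr_gt0 => //; have := sqrt_gt_line m.
by set r := Num.sqrt _ => h; lra_nu.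
Qed.

Lemma tang_fF m : tang (fF m) m = 0.
Proof.
rewrite /tang /fF; set r := Num.sqrt _.
have d0 : (1 + nu) * m + r != 0.
  by rewrite gt_eqF //; have := sqrt_gt_line m; rewrite -/r; lra_nu.
have r2 : r ^+ 2 = (1 + nu) * E m.
  by rewrite sqr_sqrtr // mulr_ge0 ?ltW ?Eden_gt0 // k0.
have -> : (1 + nu) * (1 - 2 * m) * (nu / ((1 + nu) * m + r)) ^+ 2 +
  2 * (1 + nu) * m * (nu / ((1 + nu) * m + r)) - nu =
  nu * ((1 + nu) * (1 - 2 * m) * nu + ((1 + nu) * m) ^+ 2 - r ^+ 2)
    / ((1 + nu) * m + r) ^+ 2 by field.
rewrite r2 /Eden.
rewrite [X in nu * X](_ : _ = 0) ?mulr0 ?mul0r //; ring.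
Qed.

Lemma umb_gt0 : 0 < umb. Proof. by rewrite divr_gt0 // k0. Qed.

Lemma fF_le_umb m : 2^-1 <= m -> fF m <= umb.
Proof.
move=> m0; have h : 1 + nu <= (1 + nu) * m + Num.sqrt ((1 + nu) * E m).
  rewrite -lerBlDl; apply: le_trans (ler_norm _) _; rewrite -sqrtr_sqr.
  apply: ler_wsqrtr; rewrite -subr_ge0 /Eden.
  have -> : (1 + nu) * (m ^+ 2 + nu * (1 - m) ^+ 2) -
    (1 + nu - (1 + nu) * m) ^+ 2 = (1 + nu) * (2 * m - 1) by ring.
  by rewrite mulr_ge0 //; lra_nu.
rewrite /fF /umb ler_pM2l // lef_pV2 ?posrE //; lra_nu.
Qed.

Lemma fS_gt0 m : 0 < m -> 0 < fS m.
Proof. by move=> m0; rewrite divr_gt0 ?denS_gt0 // mulr_gt0. Qed.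

(** For m > 1/2 the chord from S(M) to m is less steep than the tangent at
S(M), which puts S(M) to the right of F(M). *)
Lemma tang_fS m : tang (fS m) m = nu ^+ 2 * (2 * m - 1) * E m / denS m ^+ 2.
Proof.
have d0 : denS m != 0 by rewrite gt_eqF ?denS_gt0.
have EN : E m = denS m - (1 + nu) * m ^+ 2 by rewrite /denS /Eden; ring.
have m2 : (1 + nu) * m ^+ 2 * 2 = denS m + nu * (2 * m - 1).
  by rewrite /denS; ring.
rewrite EN /tang /fS.
have -> : (1 + nu) * (1 - 2 * m) * (nu * m / denS m) ^+ 2 +
  2 * (1 + nu) * m * (nu * m / denS m) - nu =
  nu * ((1 - 2 * m) * nu * ((1 + nu) * m ^+ 2) +
     ((1 + nu) * m ^+ 2 * 2) * denS m - denS m ^+ 2) / denS m ^+ 2.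
  by field.
rewrite m2; congr (_ / _); ring.
Qed.

Lemma fF1 : fF 1 = sD2 muw muo mug.
Proof.
rewrite /fF /sD2 (_ : E 1 = 1); last by rewrite /Eden; ring.
rewrite !mulr1 [nu + 1]addrC; set w := Num.sqrt _.
have w0 : 0 < w by rewrite sqrtr_gt0 ltr_wpDl.
have w2 : 1 + nu = w ^+ 2 by rewrite sqr_sqrtr // ltW // k0.
have -> : nu = w ^+ 2 - 1 by rewrite -w2; ring.
rewrite subrKC; field; rewrite gt_eqF //=; last by rewrite gt_eqF //; lra_nu.
Qed.

Lemma fS1 : fS 1 = sD1 muw muo mug.
Proof. by rewrite /fS /sD1 /denS; congr (_ / _); ring. Qed.

Section UnitRange.
Hypothesis nu1 : nu <= 1.

Local Ltac lra_nu1 := have := nu0; have := nu1; lra.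
Local Ltac nra_nu1 := have := nu0; have := nu1; nra.

Lemma umb_le_half : umb <= 2^-1.
Proof. by rewrite ler_pdivrMr ?k0 //; lra_nu1. Qed.

(** The difference of the two sides carries the factor (2 m - 1) ((1 + nu) m -
nu), whose zeros are the parameters of D_0 and of the umbilic point. *)
Lemma fS_le_umb m : 2^-1 <= m -> fS m <= umb.
Proof.
move=> m0; rewrite /fS /umb ler_pdivrMr ?denS_gt0 // [leRHS]mulrAC.
rewrite ler_pdivlMr ?k0 // -mulrA ler_pM2l // -subr_ge0.
have -> : denS m - m * (1 + nu) = (2 * m - 1) * ((1 + nu) * m - nu).
  by rewrite /denS; ring.
rewrite mulr_ge0 //; first lra_nu1.
nra_nu1.
Qed.

Lemma fF_lt1 m : 2^-1 <= m -> fF m < 1.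
Proof.
move=> m0; have := fF_le_umb m0; have := umb_le_half; lra_nu1.
Qed.

Lemma fS_lt1 m : 2^-1 <= m -> fS m < 1.
Proof.
move=> m0; have := fS_le_umb m0; have := umb_le_half; lra_nu1.
Qed.

Lemma tang_ge0 s m : 0 <= s < 1 -> 2^-1 <= m <= 1 ->
  (0 <= tang s m) = (fF m <= s).
Proof.
move=> /andP[s0 s1] m01; have m0 : 2^-1 <= m by case/andP: m01.
rewrite -(tang_fF m); case: (ltgtP (fF m) s) => [h|h|->].
- by rewrite ltW // tang_incr // ltW // fF_gt0.
- by apply/negbTE; rewrite -ltNge tang_incr // fF_lt1.
- by rewrite lexx.
Qed.

Lemma tang_eq0 s m : 0 <= s < 1 -> 2^-1 <= m <= 1 ->
  tang s m = 0 -> s = fF m.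
Proof.
move=> /andP[s0 s1] m01 ts; have m0 : 2^-1 <= m by case/andP: m01.
have F0 := ltW (fF_gt0 m); have F1 := fF_lt1 m0.
case: (ltgtP s (fF m)) => // h.
- by have := tang_incr s0 F1 m01 h; rewrite tang_fF ts ltxx.
- by have := tang_incr F0 s1 m01 h; rewrite tang_fF ts ltxx.
Qed.

Lemma fF_lt_fS m : 2^-1 < m <= 1 -> fF m < fS m.
Proof.
move=> /andP[m0 m1]; have h0 : (0 : R) < 2^-1 by rewrite invr_gt0.
have m01 : 2^-1 <= m <= 1 by rewrite ltW.
rewrite lt_neqAle -tang_ge0 //; last first.
  by rewrite ltW ?fS_gt0 ?(lt_trans h0) // fS_lt1 // ltW.
have t0 : 0 < tang (fS m) m.
  rewrite tang_fS divr_gt0 ?exprn_gt0 ?denS_gt0 // mulr_gt0 ?Eden_gt0 //.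
  rewrite mulr_gt0 ?exprn_gt0 //; lra_nu1.
rewrite ltW // andbT; apply: contraTneq t0 => <-.
by rewrite tang_fF ltxx.
Qed.

Lemma umb_params : fF 2^-1 = umb /\ fS 2^-1 = umb.
Proof.
have knz : 1 + nu != 0 by rewrite gt_eqF // k0.
have h0 : (2^-1 : R) <= (2^-1 : R) <= 1 by apply/andP; split; lra.
have u01 : 0 <= umb < 1.
  by have := umb_gt0; have := umb_le_half; move=> *; apply/andP; split; lra_nu1.
split.
- apply/esym/tang_eq0 => //; rewrite /tang /umb; field; exact: knz.
- rewrite /fS /umb /denS; field; rewrite knz /=.
  rewrite gt_eqF //; lra_nu1.
Qed.

(** The factor multiplying 1 - m is affine and nondecreasing in m; at m = 1/2
it equals (1 - s) (1 - nu) / 2 + s, which is nonnegative because nu <= 1. *)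
Lemma sigma1_le_sigma s m : 0 <= s <= 1 -> 2^-1 <= m <= 1 -> sg s 1 <= sg s m.
Proof.
move=> /andP[s0 s1] /andP[m0 m1]; rewrite -subr_ge0.
have -> : sg s m - sg s 1 = nu * (1 - m) *
    ((1 - s) * (1 + nu) * m + s - nu * (1 - s)) / (E s * E m).
  have E1 : E 1 = 1 by rewrite /Eden; ring.
  have -> : nu * (1 - m) * ((1 - s) * (1 + nu) * m + s - nu * (1 - s)) =
    nu * (s + m - 2 * s * m) - nu * (1 - s) * E m by rewrite /Eden; ring.
  by rewrite /sigma E1; field; rewrite !Enz.
apply: divr_ge0; last by rewrite ltW // mulr_gt0 ?Eden_gt0.
apply: mulr_ge0; first by apply: mulr_ge0; lra_nu1.
have : 0 <= (1 - s) * (1 + nu) * (m - 2^-1).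
  by rewrite !mulr_ge0 //; lra_nu1.
have : 0 <= (1 - s) * (1 - nu) by rewrite mulr_ge0 //; lra_nu1.
lra_nu1.
Qed.

(** For m = 1/2 the quadratic [tang] degenerates to (1 + nu) s - nu, which is
negative on the left of the umbilic point. *)
Lemma lam_b_le_sigma_half s : s <= umb -> lam_b s <= sg s 2^-1.
Proof.
move=> su; rewrite -subr_ge0 -opprB oppr_ge0 lam_b_sub_sigma.
rewrite pmulr_lle0 ?invr_gt0 ?mulr_gt0 ?exprn_gt0 ?Eden_gt0 //.
rewrite mulr_ge0_le0 //.
  by rewrite mulr_ge0 ?(ltW nu0) //; have := umb_le_half; lra_nu1.
have : s * (1 + nu) <= nu by rewrite -ler_pdivlMr ?k0.
rewrite /tang; lra_nu1.
Qed.

(** The right state is a saddle for every shock of interest. The upper bound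
amounts to m (denS s) > nu s, which holds for m = 1/2 in the weak sense since
2 ((1 + nu) s - nu)^2 + nu (1 - nu) >= 0. *)
Lemma right_hyperbolic s m : 2^-1 < m <= 1 -> 0 < s <= umb -> 0 <= tang s m ->
  lam_b m < sg s m < lam_a m.
Proof.
move=> /andP[m0 m1] /andP[s0 su] t0; have uh := umb_le_half.
have sm : s < m by lra_nu1.
have n0 : 0 < m + s - 2 * s * m by nra_nu1.
apply/andP; split.
- rewrite sigmaC -subr_lt0 lam_b_sub_sigma.
  rewrite pmulr_llt0 ?invr_gt0 ?mulr_gt0 ?exprn_gt0 ?Eden_gt0 //.
  rewrite pmulr_llt0 ?pmulr_rlt0 //; first lra_nu1.
  rewrite -(subrK (tang s m) (tang m s)) ltr_wpDr // tangC.
  by rewrite !mulr_gt0 ?k0 // subr_gt0.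
- rewrite sigmaC -subr_lt0 sigma_sub_lam_a.
  rewrite pmulr_llt0 ?invr_gt0 ?mulr_gt0 ?Eden_gt0 // subr_lt0.
  have : 2^-1 * denS s < m * denS s by rewrite ltr_pM2r ?denS_gt0.
  apply: le_lt_trans.
  rewrite -(ler_pM2l (_ : 0 < 2 * (1 + nu))); last by lra_nu1.
  rewrite -subr_ge0 /denS.
  have -> : 2 * (1 + nu) *
    (2^-1 * (2 * (1 + nu) * s ^+ 2 - 2 * nu * s + nu)) -
    2 * (1 + nu) * (nu * s) =
    2 * ((1 + nu) * s - nu) ^+ 2 + nu * (1 - nu) by field.
  apply: addr_ge0; last by apply: mulr_ge0; lra_nu1.
  by apply: mulr_ge0; rewrite ?sqr_ge0.
Qed.

Lemma fS_inj : {in `[2^-1, 1] &, injective fS}.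
Proof.
move=> m n; rewrite !in_itv /= => /andP[m0 m1] /andP[n0 n1].
wlog mn : m n m0 m1 n0 n1 / m <= n.
  by move=> W; case: (leP m n) => [/W|/ltW/W h /esym e]; [exact|apply/esym/h].
move=> e.
have fSK t : nu * t = fS t * denS t by rewrite divfK ?gt_eqF ?denS_gt0.
have : nu * n * denS m - nu * m * denS n = 0.
  by rewrite !fSK e; ring.
rewrite (_ : _ - _ = nu * (n - m) * (nu - 2 * (1 + nu) * m * n)).
  (* For nu = 1 the second factor vanishes at m = n = 1/2 only. *)
  move/eqP; rewrite mulf_eq0 mulf_eq0 gt_eqF //= subr_eq0 => /orP[/eqP->//|].
  move=> /eqP h; have : 4^-1 <= m * n by nra_nu1.
  nra_nu1.
by rewrite /denS; ring.
Qed.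

Lemma fF_inj : {in `[2^-1, 1] &, injective fF}.
Proof.
move=> m n; rewrite !in_itv /= => /andP[m0 m1] /andP[n0 n1] mn.
have : tang (fF m) m - tang (fF n) n = 0 by rewrite !tang_fF subrr.
rewrite mn.
rewrite (_ : _ - _ = 2 * (1 + nu) * fF n * (1 - fF n) * (m - n)).
  have F1 := fF_lt1 n0; have F0 := fF_gt0 n.
  move: (fF n) F0 F1 => F F0 F1.
  move/eqP; rewrite !mulf_eq0 !subr_eq0 (gt_eqF F0) (gt_eqF F1) (gt_eqF k0).
  by rewrite pnatr_eq0 /= => /eqP.
by rewrite /tang; ring.
Qed.

Lemma sigma_decr l s m : 0 <= l -> l < s -> m <= 1 -> s < m -> 0 <= tang l m ->
  sg s m < sg l m.
Proof.
move=> l0 ls m1 sm t0; rewrite -subr_gt0 sigma_sub_sigma.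
apply: divr_gt0; last by rewrite !mulr_gt0 ?Eden_gt0.
apply: mulr_gt0; first by rewrite mulr_gt0 ?subr_gt0.
apply: ltr_wpDl => //; apply: mulr_gt0; last by rewrite subr_gt0.
by apply: mulr_gt0 => //; nra.
Qed.

End UnitRange.
End LineAlgebra.

(** * Characteristic speeds and shocks on the line *)

Section Flow.
Context {R : realType}.

(** The differential of the flux is assembled from those of the two coordinate
forms. *)
Lemma is_diff_coord n (x : 'rV[R]_n) (j : 'I_n) :
  is_diff x (fun U : 'rV[R]_n => U 0 j) (fun v : 'rV[R]_n => v 0 j).
Proof.
pose f (U : 'rV[R]_n) : R := U 0 j.
have flin : linear f by move=> a u v; rewrite /f !mxE.
pose fM := GRing.isLinear.Build _ _ _ _ _ flin.
pose fL : {linear 'rV[R]_n -> R} := HB.pack f fM.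
have cf : continuous fL := @coord_continuous R 1 n 0 j.
apply: DiffDef; first exact: (@linear_differentiable _ _ _ fL).
exact: (@diff_lin _ _ _ fL).
Qed.

Lemma is_diff_div (V : normedModType R) (f g df dg : V -> R) (x : V) :
  is_diff x f df -> is_diff x g dg -> g x != 0 ->
  is_diff x (fun y => f y / g y)
    (fun v => (df v * g x - f x * dg v) / g x ^+ 2).
Proof.
move=> Df Dg gx.
have dV : is_diff x (fun y => (g y)^-1) (fun v => - (g x) ^- 2 * dg v).
  apply: DiffDef; first exact: differentiableV.
  by rewrite diffV // diff_val.
apply: is_diff_eq (is_diffM Df dV) _.
by apply/funext => v; rewrite !fctE /GRing.scale /=; field.
Qed.

Lemma diff_combination (V W : normedModType R) (k1 k2 : V -> R) (e1 e2 : W)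
    (x v : V) : differentiable k1 x -> differentiable k2 x ->
  'd (fun U => k1 U *: e1 + k2 U *: e2) x v =
  'd k1 x v *: e1 + 'd k2 x v *: e2.
Proof.
move=> d1 d2.
have -> : (fun U => k1 U *: e1 + k2 U *: e2) =
  (fun U => k1 U *: e1) + (fun U => k2 U *: e2) by [].
rewrite diffD; [|exact: differentiableZl..].
by rewrite /= !diffZl.
Qed.

Variables muw muo mug : R.
Hypotheses (hw : 0 < muw) (ho : 0 < muo) (hg : 0 < mug).
Implicit Types s t l m : R.
Local Notation nu := (nuG muw muo mug).
Local Notation E := (Eden muw muo mug).
Local Notation sg := (sigma muw muo mug).
Local Notation st := (state muw muo).
Local Notation F := (flux muw muo mug).

Let M0 : 0 < muw + muo. Proof. exact: addr_gt0. Qed.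

Lemma nuG_gt0 : 0 < nu. Proof. exact: divr_gt0. Qed.
Let nu0 := nuG_gt0.

Lemma stateE s : st s = s *: st 1.
Proof.
by apply/rowP => j; rewrite !mxE; case: ifP => _; rewrite mul1r.
Qed.

Lemma stateB s t : st s - st t = (s - t) *: st 1.
Proof. by rewrite (stateE s) (stateE t) -scalerBl. Qed.

Lemma sat_w_state s : sat_w (st s) = s * (muw / (muw + muo)).
Proof. by rewrite /sat_w mxE. Qed.

Lemma sat_o_state s : sat_o (st s) = s * (muo / (muw + muo)).
Proof. by rewrite /sat_o mxE. Qed.

Lemma paramK s : param (st s) = s.
Proof.
by rewrite /param sat_w_state sat_o_state; field; rewrite gt_eqF.
Qed.

Lemma Omega_state s : 0 <= s <= 1 -> Omega (st s).
Proof.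
move=> /andP[s0 s1]; split.
- by rewrite sat_w_state mulr_ge0 // divr_ge0 // ltW.
- by rewrite sat_o_state mulr_ge0 // divr_ge0 // ltW.
- by have := paramK s; rewrite /param => ->.
Qed.

Lemma line_GDP (x : 'rV[R]_2) :
  line_GD muw muo x <-> exists2 s, 0 <= s <= 1 & x = st s.
Proof.
split=> [[[xw xo xwo] xe]|[s s01 ->]].
  exists (param x); first by rewrite xwo addr_ge0.
  apply/rowP => j; rewrite mxE /param; move: xe; rewrite /sat_w /sat_o => xe.
  have xo' : x 0 1 = x 0 0 / muw * muo by rewrite xe divfK // gt_eqF.
  case: ifPn => j0.
    by rewrite (eqP j0) xo'; field; rewrite !gt_eqF.
  have -> : j = 1 by apply/val_inj; case: j j0 => [[|[|[]]]].
  by rewrite xo'; field; rewrite !gt_eqF.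
split; first exact: Omega_state.
by rewrite sat_w_state sat_o_state; field; rewrite !gt_eqF.
Qed.

Lemma sat_g_state s : sat_g (st s) = 1 - s.
Proof.
by rewrite /sat_g -[in RHS](paramK s) /param opprD addrA.
Qed.

Lemma total_mobility_state s :
  total_mobility muw muo mug (st s) = E s / (muw + muo).
Proof.
rewrite /total_mobility sat_g_state sat_w_state sat_o_state /Eden /nuG.
by field; rewrite !gt_eqF.
Qed.

Lemma flux_state s : F (st s) = st (s ^+ 2 / E s).
Proof.
have En : E s != 0 by rewrite gt_eqF // Eden_gt0.
rewrite /flux total_mobility_state sat_w_state sat_o_state /state.
by congr mk_state; field; rewrite En !gt_eqF.
Qed.

Lemma rankine_hugoniot l m : F (st m) - F (st l) = sg l m *: (st m - st l).
Proof.
have En s : E s != 0 by rewrite gt_eqF // Eden_gt0.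
rewrite !flux_state !stateB scalerA; congr (_ *: _).
have -> : sg l m * (m - l) = (m ^+ 2 * E l - l ^+ 2 * E m) / (E l * E m).
  rewrite /sigma mulrAC; congr (_ / _); rewrite /Eden; ring.
by field; rewrite !En.
Qed.

Lemma state_continuous : continuous st.
Proof.
have -> : st = (fun s => s *: st 1) by apply/funext => s; exact: stateE.
exact: scalel_continuous.
Qed.

Lemma Eden_continuous : continuous E.
Proof.
have -> : E = (fun s => s * s + nu * ((1 - s) * (1 - s))).
  by apply/funext => s; rewrite /Eden !expr2.
move=> s; apply: cvgD; first by apply: cvgM; exact: cvg_id.
apply: cvgM; first exact: cvg_cst.
by apply: cvgM; apply: cvgB; [exact: cvg_cst|exact: cvg_id|exact: cvg_cst|
  exact: cvg_id].
Qed.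

(** The inequality [tang l m >= 0] says that the characteristic speed along
the line at l is at least the shock speed, so l repels the orbit, possibly
only to second order; the numerator of Z is affine and increasing, hence
positive beyond l. *)
Lemma line_shock l m : 0 <= l -> l < m -> m <= 1 ->
  0 <= tang muw muo mug l m -> shock muw muo mug (st l) (st m) (sg l m).
Proof.
move=> l0 lm m1 t0.
have Es s : 0 < E s by exact: Eden_gt0.
have En s : E s != 0 by rewrite gt_eqF.
pose Z s := nu * (tang muw muo mug l m +
  (l + m - 2 * l * m) * (1 + nu) * (s - l)) / (E l * E s * E m).
have cE := Eden_continuous.
have cZ : continuous Z.
  move=> s; apply: cvgM.
    apply: cvgM; first exact: cvg_cst.
    apply: cvgD; first exact: cvg_cst.
    apply: cvgM; first exact: cvg_cst.
    by apply: cvgB; [exact: cvg_id|exact: cvg_cst].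
  apply: cvgV; first by rewrite !mulf_neq0.
  apply: cvgM; last exact: cvg_cst.
  by apply: cvgM; [exact: cvg_cst|exact: cE].
have Z0 s : l < s < m -> 0 < Z s.
  move=> /andP[ls sm]; apply: divr_gt0; last by rewrite !mulr_gt0.
  apply: mulr_gt0 => //; apply: ltr_wpDl => //.
  apply: mulr_gt0; last by rewrite subr_gt0.
  by apply: mulr_gt0; [nra|rewrite ltr_wpDl].
have XE s : s ^+ 2 / E s - l ^+ 2 / E l - sg l m * (s - l) =
    (s - l) * (m - s) * Z s.
  have -> : s ^+ 2 / E s - l ^+ 2 / E l = sg l s * (s - l).
    have -> : sg l s * (s - l) = (s ^+ 2 * E l - l ^+ 2 * E s) / (E l * E s).
      rewrite /sigma mulrAC; congr (_ / _); rewrite /Eden; ring.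
    by field; rewrite !En.
  have -> : sg l s = sg l m + (m - s) * Z s.
    apply/eqP; rewrite addrC -subr_eq; apply/eqP.
    have -> : (m - s) * Z s = nu * ((l + s - 2 * l * s) * E m -
        (l + m - 2 * l * m) * E s) / (E l * E s * E m).
      by rewrite /Z mulrA; congr (_ / _); rewrite /tang /Eden; ring.
    by rewrite /sigma; field; rewrite !En.
  by ring.
have [phi [philm dphi phil phim]] := heteroclinic_orbit lm cZ Z0.
split.
- by apply: Omega_state; rewrite l0 (le_trans (ltW lm)).
- by apply: Omega_state; rewrite m1 (le_trans l0 (ltW lm)).
- exact: rankine_hugoniot.
exists (fun t => st (phi t)); split.
- move=> t; apply: Omega_state; have /andP[a b] := philm t.
  by rewrite (le_trans l0 (ltW a)) (le_trans (ltW b)).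
- move=> t.
  have -> : (fun t => st (phi t)) = (fun t => phi t *: st 1).
    by apply/funext => u; exact: stateE.
  have dp : differentiable phi t by apply/derivable1_diffP; case: (dphi t).
  apply: DeriveDef; first exact/diff_derivable/differentiableZl.
  rewrite deriveE; last exact: differentiableZl.
  rewrite diffZl // -deriveE //; have [_ ->] := dphi t.
  rewrite -XE !flux_state !stateB scalerA -scalerBl.
  by congr (_ *: _).
- by apply: cvg_comp phil _; exact: state_continuous.
- by apply: cvg_comp phim _; exact: state_continuous.
Qed.

Lemma is_diff_total_mobility s :
  is_diff (st s) (total_mobility muw muo mug)
    (fun v => 2 / (muw + muo) * (s - nu * (1 - s)) * param v).
Proof.
pose w := st s.
have dw : is_diff w (@sat_w R) (@sat_w R) := is_diff_coord w 0.
have do_ : is_diff w (@sat_o R) (@sat_o R) := is_diff_coord w 1.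
have dg : is_diff w (@sat_g R) (fun v => - sat_w v - sat_o v).
  have -> : @sat_g R = cst 1 - @sat_w R - @sat_o R by [].
  by apply: is_diff_eq; apply/funext => v; rewrite !fctE sub0r.
have -> : total_mobility muw muo mug = muw^-1 *: (@sat_w R ^+ 2) +
    muo^-1 *: (@sat_o R ^+ 2) + mug^-1 *: (@sat_g R ^+ 2).
  by apply/funext => U; rewrite !fctE /GRing.scale /= /total_mobility;
    congr (_ + _ + _); rewrite mulrC.
have d := is_diffD (is_diffD (is_diffZ muw^-1 (is_diffX 1 dw))
  (is_diffZ muo^-1 (is_diffX 1 do_))) (is_diffZ mug^-1 (is_diffX 1 dg)).
apply: (is_diff_eq d); apply/funext => v; rewrite !fctE /GRing.scale /= !expr1.
rewrite /w sat_g_state sat_w_state sat_o_state /param /nuG.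
by field; rewrite !gt_eqF.
Qed.

(** The gradient of the total mobility at a state of the line is proportional
to the form [param], which is why the Jacobian is a scalar matrix plus a
matrix of rank one with image along the line. *)
Lemma jacobian_state s (v : 'rV[R]_2) :
  v *m jacobian F (st s) = lam_a muw muo mug s *: v -
    (2 * s ^+ 2 * (s - nu * (1 - s)) / E s ^+ 2 * param v) *: st 1.
Proof.
have En : E s != 0 by rewrite gt_eqF // Eden_gt0.
have Mn : muw + muo != 0 by rewrite gt_eqF.
have dT := is_diff_total_mobility s.
have T0 : total_mobility muw muo mug (st s) != 0.
  by rewrite total_mobility_state mulf_neq0 // invr_eq0.
set dtm := (fun v => _) in dT.
have dw : is_diff (st s) (@sat_w R) (@sat_w R) := is_diff_coord (st s) 0.
have do_ : is_diff (st s) (@sat_o R) (@sat_o R) := is_diff_coord (st s) 1.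
pose A U := (muw^-1 *: (@sat_w R ^+ 2)) U / total_mobility muw muo mug U.
pose B U := (muo^-1 *: (@sat_o R ^+ 2)) U / total_mobility muw muo mug U.
have dA := is_diff_div (is_diffZ muw^-1 (is_diffX 1 dw)) dT T0.
have dB := is_diff_div (is_diffZ muo^-1 (is_diffX 1 do_)) dT T0.
have FE : F = (fun U => A U *: mk_state 1 0 + B U *: mk_state 0 1).
  apply/funext => U; apply/rowP => j; rewrite !mxE /A /B.
  rewrite !fctE /GRing.scale /=.
  by case: ifP => _; rewrite !(mulr0, mulr1, addr0, add0r); congr (_ / _);
    rewrite mulrC.
have [dfA vA] := dA; have [dfB vB] := dB.
rewrite /jacobian mul_rV_lin1 FE (diff_combination _ _ _ dfA dfB).
rewrite vA vB.
rewrite !fctE /GRing.scale /= !expr1 total_mobility_state.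
rewrite sat_w_state sat_o_state /dtm /param.
apply/rowP => j; rewrite !mxE.
have jE : j = 0 \/ j = 1.
  by case: j => [[|[|//]] i]; [left|right]; apply/val_inj.
rewrite /lam_a /sat_w /sat_o.
by case: jE => -> /=; field; rewrite En Mn !gt_eqF.
Qed.

(** The kernel of [param] is an eigenspace for [lam_a]; applying [param] to an
eigenvector outside it gives the eigenvalue [lam_b]. *)
Lemma eigenvalues_state s : [set a | eigenvalue (jacobian F (st s)) a] =
  [set lam_a muw muo mug s; lam_b muw muo mug s].
Proof.
have En : E s != 0 by rewrite gt_eqF // Eden_gt0.
have sum a (v : 'rV[R]_2) : v *m jacobian F (st s) = a *: v ->
    lam_b muw muo mug s * param v = a * param v.
  rewrite jacobian_state => /rowP h; have := h 0; have := h 1.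
  rewrite !mxE /= => h1 h0.
  have -> : a * param v = a * v 0 0 + a * v 0 1 by rewrite /param mulrDr.
  rewrite -h0 -h1.
  set g := 2 * s ^+ 2 * (s - nu * (1 - s)) / E s ^+ 2.
  have -> : lam_b muw muo mug s = lam_a muw muo mug s - g.
    have -> : lam_b muw muo mug s =
      (2 * s * E s - 2 * s ^+ 2 * (s - nu * (1 - s))) / E s ^+ 2.
      by rewrite /lam_b /Eden; congr (_ / _); ring.
    by rewrite /lam_a /g; field.
  rewrite /param /sat_w /sat_o; field; rewrite gt_eqF //.
apply/seteqP; split => a /=.
  move=> /eigenvalueP[v vJ v0]; have := sum _ _ vJ => /eqP.
  rewrite -subr_eq0 -mulrBl mulf_eq0 subr_eq0 => /orP[/eqP ->|/eqP p0].
    by right.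
  move: vJ; rewrite jacobian_state p0 mulr0 scale0r subr0 => /eqP.
  rewrite -subr_eq0 -scalerBl scaler_eq0 (negbTE v0) orbF subr_eq0 => /eqP ->.
  by left.
case=> ->; apply/eigenvalueP.
- exists (mk_state 1 (- 1)); last first.
    apply/eqP => /rowP /(_ 0); rewrite !mxE /= => /eqP; rewrite oner_eq0 //.
  rewrite jacobian_state (_ : param _ = 0) ?mulr0 ?scale0r ?subr0 //.
  by rewrite /param /sat_w /sat_o !mxE /= subrr.
- exists (st 1); last first.
    apply/eqP => h; have := paramK 1; rewrite h /param /sat_w /sat_o !mxE addr0.
    by move/eqP; rewrite eq_sym oner_eq0.
  rewrite jacobian_state paramK mulr1 -scalerBl; congr (_ *: _).
  have -> : lam_b muw muo mug s =
      (2 * s * E s - 2 * s ^+ 2 * (s - nu * (1 - s))) / E s ^+ 2.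
    by rewrite /lam_b /Eden; congr (_ / _); ring.
  by rewrite /lam_a; field.
Qed.

Let inf_set2 (a b : R) : a <= b -> inf [set a; b] = a.
Proof.
move=> ab; apply/eqP; rewrite eq_le; apply/andP; split.
  by apply: ge_inf; [exists a => x /= [->|->] //|left].
by apply: lb_le_inf; [exists a; left|move=> x /= [->|->]].
Qed.

Let sup_set2 (a b : R) : a <= b -> sup [set a; b] = b.
Proof.
move=> ab; apply/eqP; rewrite eq_le; apply/andP; split.
  by apply: ge_sup; [exists a; left|move=> x /= [->|->]].
by apply: ub_le_sup; [exists b => x /= [->|->] //|right].
Qed.

Lemma lambda_left s : 0 <= s <= umb muw muo mug ->
  lambda_s muw muo mug (st s) = lam_a muw muo mug s /\
  lambda_f muw muo mug (st s) = lam_b muw muo mug s.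
Proof.
move=> /andP[s0 su]; rewrite /lambda_s /lambda_f eigenvalues_state.
suff h : lam_a muw muo mug s <= lam_b muw muo mug s.
  by rewrite inf_set2 // sup_set2.
move: s0; rewrite le_eqVlt => /predU1P[<-|s0]; last by rewrite lam_a_le_lam_b.
by rewrite /lam_a /lam_b !(mulr0, mul0r).
Qed.

Lemma lambda_right s : 0 < s -> umb muw muo mug <= s ->
  lambda_s muw muo mug (st s) = lam_b muw muo mug s /\
  lambda_f muw muo mug (st s) = lam_a muw muo mug s.
Proof.
move=> s0 us; rewrite /lambda_s /lambda_f eigenvalues_state setUC.
suff h : lam_b muw muo mug s <= lam_a muw muo mug s.
  by rewrite inf_set2 // sup_set2.
rewrite -subr_le0 lam_b_sub_lam_a // pmulr_lle0; last first.
  by rewrite invr_gt0 exprn_gt0 // Eden_gt0.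
rewrite pmulr_rle0; last by rewrite mulr_gt0 // exprn_gt0.
by rewrite subr_le0 mulrC -[X in X <= _](divfK (_ : 1 + nu != 0))
  ?ler_pM2r ?gt_eqF ?ltr_wpDl.
Qed.

End Flow.

(** * Special states and shock domains *)

Section Surface.
Context {R : realType}.
Variables muw muo mug : R.
Hypotheses (hw : 0 < muw) (ho : 0 < muo) (hg : 0 < mug).
Implicit Types s t l m v : R.
Local Notation nu := (nuG muw muo mug).
Local Notation E := (Eden muw muo mug).
Local Notation sg := (sigma muw muo mug).
Local Notation st := (state muw muo).
Local Notation S := (fS muw muo mug).
Local Notation F := (fF muw muo mug).
Local Notation u := (umb muw muo mug).
Local Notation la := (lam_a muw muo mug).
Local Notation lb := (lam_b muw muo mug).
Local Notation plane := (plane_GD muw muo).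
Hypothesis nu1 : nu <= 1.

Let nu0 : 0 < nu := nuG_gt0 hw ho hg.
Let E0 s : 0 < E s := Eden_gt0 nu0 s.
Let En s : E s != 0. Proof. by rewrite gt_eqF. Qed.
Let onenu_gt0 : 0 < 1 + nu. Proof. exact: ltr_wpDl. Qed.
Let half_gt0 : (0 : R) < 2^-1. Proof. by rewrite invr_gt0. Qed.
Let half_lt1 : (2^-1 : R) < 1. Proof. by lra. Qed.
Let half_in : (2^-1 : R) <= (2^-1 : R) <= 1.
Proof. by apply/andP; split; lra. Qed.
Let one_in : (2^-1 : R) <= (1 : R) <= 1.
Proof. by apply/andP; split; lra. Qed.
Let umb_half : u <= 2^-1 := umb_le_half nu0 nu1.
Let u0 : 0 < u := umb_gt0 nu0.

Lemma umbilicE : umbilic muw muo mug = st u.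
Proof.
have Mn : muw + muo != 0 by rewrite gt_eqF // addr_gt0.
have Nn : mug + (muw + muo) != 0 by rewrite gt_eqF // !addr_gt0.
have Gn : mug != 0 by rewrite gt_eqF.
rewrite /umbilic /state /umb /nuG; congr mk_state; field;
  by rewrite Mn Nn Gn.
Qed.

Lemma sUE : sU muw muo mug = u.
Proof. by rewrite /sU umbilicE paramK. Qed.

Lemma lam_a_umb : la u = 2.
Proof.
have kn : 1 + nu != 0 by rewrite gt_eqF.
have nn : nu != 0 by rewrite gt_eqF.
have Eu : E u = u by rewrite /Eden /umb; field.
by rewrite /lam_a Eu mulfK // gt_eqF.
Qed.

Lemma lam_b_umb : lb u = 2.
Proof.
rewrite -[RHS]lam_a_umb; apply/eqP; rewrite -subr_eq0 lam_b_sub_lam_a //.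
rewrite (_ : nu - (1 + nu) * u = 0) ?mulr0 ?mul0r //.
by rewrite /umb mulrC divfK ?subrr // gt_eqF.
Qed.

Lemma sigma_umb_half : sg u 2^-1 = 2.
Proof.
rewrite -[RHS]lam_a_umb; apply/eqP; rewrite lam_a_eq_sigma //.
by rewrite (umb_params nu0 nu1).2.
Qed.

(** The equation [sigma s umb = 2] has the roots 1/2 and umb only. If nu < 1
they differ and 1/2 is the extension; if nu = 1 they agree. *)
Lemma left_f_extension_umb s :
  left_f_extension muw muo mug (sU muw muo mug) s -> s = 2^-1.
Proof.
have uu : 0 <= u <= u by rewrite lexx ltW.
rewrite sUE => -[s01]; rewrite (lambda_left hw ho hg uu).2 lam_b_umb => sE ext.
have : (2 * s - 1) * ((1 + nu) * s - nu) == 0.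
  have uE : u = S s.
    by apply/eqP; rewrite -lam_a_eq_sigma // sigmaC sE lam_a_umb.
  have uS : u * denS muw muo mug s = nu * s.
    by rewrite {1}uE divfK // gt_eqF // denS_gt0.
  have uk : u * (1 + nu) = nu by rewrite divfK // gt_eqF.
  have /(mulfI (lt0r_neq0 nu0)) H' : nu * denS muw muo mug s =
    nu * (s * (1 + nu)) by rewrite -{1}uk mulrAC uS; ring.
  apply/eqP; have := H'; rewrite /denS => e.
  have -> : (2 * s - 1) * ((1 + nu) * s - nu) =
    2 * (1 + nu) * s ^+ 2 - 2 * nu * s + nu - s * (1 + nu) by ring.
  by rewrite e subrr.
rewrite mulf_eq0 => /orP[/eqP e|/eqP e]; first lra.
have su : s = u.
  by apply: (canRL (mulfK (lt0r_neq0 onenu_gt0))); lra.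
have [->|hu] := eqVneq (2^-1 : R) u; first by [].
apply/esym/ext => //; first lra.
by rewrite sigmaC sigma_umb_half.
Qed.

Lemma frakSE m : 2^-1 <= m <= 1 -> frakS muw muo mug m = S m.
Proof.
move=> /andP[m0 m1].
have su : 0 <= S m <= u.
  by rewrite ltW ?fS_gt0 ?fS_le_umb // (lt_le_trans half_gt0).
rewrite /frakS; set P := (X in get X).
have : P (get P).
  apply: getPex; exists (S m); rewrite /P /= sUE; split => //.
  by rewrite (lambda_left hw ho hg su).1; apply/eqP; rewrite lam_a_eq_sigma.
rewrite {1}/P /= sUE => -[gu]; rewrite (lambda_left hw ho hg gu).1.
by move/eqP; rewrite lam_a_eq_sigma // => /eqP.
Qed.

(** The trivial solution s = m of the tangency equation is in range only for m
= 1/2 = umb, that is for nu = 1, where it agrees with F(M). *)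
Lemma sigma_eq_lam_b s m : 0 <= s <= u -> 2^-1 <= m <= 1 ->
  sg s m = lb s <-> s = F m.
Proof.
move=> /andP[s0 su] m01; have /andP[m0 m1] := m01.
have -> : sg s m = lb s <-> lb s - sg s m = 0.
  by split=> [->|/eqP]; rewrite ?subrr // subr_eq0 => /eqP.
rewrite lam_b_sub_sigma //; split=> [/eqP|->]; last first.
  by rewrite tang_fF // mulr0 mul0r.
have nz : E s ^+ 2 * E m != 0 by rewrite mulf_neq0 ?expf_neq0.
rewrite mulf_eq0 invr_eq0 (negbTE nz) orbF.
rewrite mulf_eq0 mulf_eq0 (gt_eqF nu0) /= subr_eq0 => /orP[/eqP e|/eqP].
  have m_half : m = 2^-1 by have := umb_half; lra.
  have su' : s = u by have := umb_half; lra.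
  by rewrite m_half (umb_params nu0 nu1).1.
by apply: tang_eq0 => //; rewrite s0 (le_lt_trans su) // (le_lt_trans umb_half).
Qed.

Lemma calFE m : 2^-1 <= m <= 1 -> calF muw muo mug m = F m.
Proof.
move=> m01; have /andP[m0 m1] := m01.
have su : 0 <= F m <= u by rewrite ltW ?fF_gt0 ?fF_le_umb.
rewrite /calF; set P := (X in get X).
have : P (get P).
  apply: getPex; exists (F m); rewrite /P /= sUE; split => //.
  by rewrite (lambda_left hw ho hg su).2; exact/sigma_eq_lam_b.
rewrite {1}/P /= sUE => -[gu]; rewrite (lambda_left hw ho hg gu).2.
by move/sigma_eq_lam_b; exact.
Qed.

Lemma fF_le_fS m : 2^-1 <= m <= 1 -> F m <= S m.
Proof.
move=> /andP[]; rewrite le_eqVlt => /predU1P[<-|m0] m1.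
  by rewrite (umb_params nu0 nu1).1 (umb_params nu0 nu1).2.
by rewrite ltW // fF_lt_fS // m0.
Qed.

Let F1S1 : F 1 < S 1.
Proof. by apply: fF_lt_fS => //; rewrite half_lt1 lexx. Qed.

Let S1_lt1 : S 1 < 1.
Proof. by apply: fS_lt1 => //; exact: ltW. Qed.

Lemma shock_to_right_state l m : 2^-1 < m <= 1 -> 0 < l <= u ->
    0 <= tang muw muo mug l m ->
  [/\ shock muw muo mug (st l) (st m) (sg l m),
      lambda_s muw muo mug (st m) < sg l m &
      sg l m < lambda_f muw muo mug (st m)].
Proof.
move=> m01 l0 t0; have /andP[m0 m1] := m01; have /andP[l0' lu] := l0.
have um : u <= m by apply: le_trans umb_half (ltW m0).
have [-> ->] := lambda_right hw ho hg (lt_trans half_gt0 m0) um.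
have /andP[a b] := right_hyperbolic nu0 nu1 m01 l0 t0.
split => //; apply: line_shock => //; first exact: ltW.
by apply: le_lt_trans lu _; apply: le_lt_trans umb_half _.
Qed.

(** At m = 1/2 the left state is the umbilic point, where the two
characteristic speeds agree; the closure takes care of this end point. *)
Lemma SCB_dom_sandwich : `]2^-1, 1[ `<=` SCB_dom muw muo mug 2^-1 /\
  SCB_dom muw muo mug 2^-1 `<=` `[2^-1, 1].
Proof.
split=> m; last by case; rewrite /= in_itv.
rewrite /= in_itv /= => /andP[m0 m1].
have m01 : 2^-1 <= m <= 1 by rewrite !ltW.
have m01' : 2^-1 < m <= 1 by rewrite m0 ltW.
split => //; rewrite frakSE //.
have Su : 0 < S m <= u.
  by rewrite fS_gt0 ?fS_le_umb ?(ltW m0) ?(lt_trans half_gt0 m0).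
have Su' : 0 <= S m <= u by case/andP: Su => /ltW-> ->.
have [|sh a b] := shock_to_right_state m01' Su.
  rewrite tang_ge0 ?fF_le_fS //.
  by case/andP: Su' => -> /le_lt_trans ->//; exact: le_lt_trans half_lt1.
split => //; rewrite (lambda_left hw ho hg Su').1.
by apply/eqP; rewrite lam_a_eq_sigma.
Qed.

Lemma UCB_dom_sandwich : `]2^-1, 1[ `<=` UCB_dom muw muo mug 2^-1 /\
  UCB_dom muw muo mug 2^-1 `<=` `[2^-1, 1].
Proof.
split=> m; last by case; rewrite /= in_itv.
rewrite /= in_itv /= => /andP[m0 m1].
have m01 : 2^-1 <= m <= 1 by rewrite !ltW.
have m01' : 2^-1 < m <= 1 by rewrite m0 ltW.
split => //; rewrite calFE //.
have Fu : 0 < F m <= u by rewrite fF_gt0 ?fF_le_umb ?(ltW m0).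
have Fu' : 0 <= F m <= u by case/andP: Fu => /ltW-> ->.
have [|sh a b] := shock_to_right_state m01' Fu; first by rewrite tang_fF.
have [ls lf] := lambda_left hw ho hg Fu'.
rewrite /left_char_u_shock ls lf; split; rewrite ?a ?b //;
  last exact/sigma_eq_lam_b.
rewrite lt_neqAle lam_a_le_sigma // fF_le_fS // andbT eq_sym lam_a_eq_sigma //.
by rewrite lt_eqF // fF_lt_fS.
Qed.

(** * Lifting to the plane of states and speeds *)

Lemma fS_continuous : continuous S.
Proof.
move=> m; apply: cvgM; first by apply: cvgM; [exact: cvg_cst|exact: cvg_id].
apply: cvgV; first by rewrite gt_eqF // denS_gt0.
apply: cvgD; last exact: cvg_cst.
apply: cvgB; last by apply: cvgM; [exact: cvg_cst|exact: cvg_id].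
by apply: cvgM; [exact: cvg_cst|exact: exprn_continuous].
Qed.

Lemma fF_continuous : continuous F.
Proof.
move=> m; apply: cvgM; first exact: cvg_cst.
apply: cvgV; first by rewrite gt_eqF //; have := sqrt_gt_line nu0 m;
  have := nu0; set r := Num.sqrt _ => *; lra.
apply: cvgD; first by apply: cvgM; [exact: cvg_cst|exact: cvg_id].
apply: continuous_comp; last exact: sqrt_continuous.
by apply: cvgM; [exact: cvg_cst|exact: Eden_continuous].
Qed.

Lemma sigma_continuous (f g : R -> R) : continuous f -> continuous g ->
  continuous (fun m => sg (f m) (g m)).
Proof.
move=> cf cg m; apply: cvgM.
  apply: cvgM; first exact: cvg_cst.
  apply: cvgB; first by apply: cvgD; [exact: cf|exact: cg].
  apply: cvgM; last exact: cg.
  by apply: cvgM; [exact: cvg_cst|exact: cf].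
apply: cvgV; first by rewrite mulf_neq0.
by apply: cvgM;
  [apply: continuous_comp (cf m) _|apply: continuous_comp (cg m) _];
  exact: Eden_continuous.
Qed.

Lemma lam_a_continuous : continuous la.
Proof.
move=> s; apply: cvgM; first by apply: cvgM; [exact: cvg_cst|exact: cvg_id].
by apply: cvgV => //; exact: Eden_continuous.
Qed.

Lemma lam_b_continuous : continuous lb.
Proof.
move=> s; apply: cvgM.
  apply: cvgM; first by apply: cvgM; [exact: cvg_cst|exact: cvg_id].
  by apply: cvgB; [exact: cvg_cst|exact: cvg_id].
apply: cvgV; first by rewrite expf_neq0.
apply: (@continuous_comp _ _ _ E (fun x : R => x ^+ 2)).
  exact: Eden_continuous.
exact: exprn_continuous.
Qed.

Lemma lift_continuous (f g : R -> R) : continuous f -> continuous g ->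
  continuous (fun m => (st (f m), g m)).
Proof.
move=> cf cg m; apply: (@cvg_pair _ _ _ _ (nbhs (st (f m))) (nbhs (g m)));
  last exact: cg.
by apply: (@continuous_comp _ _ _ f st); [exact: cf|exact: state_continuous].
Qed.

Lemma param_continuous : continuous (@param R).
Proof.
move=> x.
exact: (cvgD (@coord_continuous R 1 2 0 0 x) (@coord_continuous R 1 2 0 1 x)).
Qed.

Lemma param_comp_continuous (f : R -> R) : continuous f ->
  continuous (fun x : 'rV[R]_2 * R => f (param x.1)).
Proof.
move=> cf x; apply: (@continuous_comp _ _ _ (fun y => param y.1) f);
  last exact: cf.
apply: (@continuous_comp _ _ _ fst (@param R)); first exact: cvg_fst.
exact: param_continuous.
Qed.

Lemma speed_coordinate_continuous : continuous (fun x : 'rV[R]_2 * R => x.2).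
Proof. by move=> x; exact: cvg_snd. Qed.

Lemma lifted_inj s t v v' : (st s, v) = (st t, v') -> s = t /\ v = v'.
Proof.
by case=> /(congr1 (@param R)); rewrite !paramK.
Qed.

Lemma planeP (x : 'rV[R]_2 * R) :
  plane x <-> exists s v, [/\ 0 <= s <= 1, 0 < v & x = (st s, v)].
Proof.
split=> [[/(line_GDP hw ho)[s s01 xs] x0]|[s [v [s01 v0 ->]]]].
  by exists s, x.2; split => //; case: x xs {x0} => a b /= ->.
by split => //; apply/(line_GDP hw ho); exists s.
Qed.

Lemma lift_norm s v : 0 < v -> v <= `|(st s, v)|.
Proof.
move=> v0; rewrite /Num.norm /= le_max; apply/orP; right.
exact: ler_norm.
Qed.

Lemma bounded_under_graph (hi : R -> R) (T : set ('rV[R]_2 * R)) :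
  continuous hi ->
  (forall s v, 0 <= s <= 1 -> 0 < v -> T (st s, v) -> v <= hi s) ->
  bounded_set (plane `&` T).
Proof.
move=> chi Thi.
have [c _ hc] := EVT_max ler01 (continuous_subspaceT chi).
exists (Num.max `|st 1| (hi c)); split; first exact: num_real.
move=> M; rewrite gt_max => /andP[M1 M2] x [/planeP[s [v [s01 v0 ->]]] Tx] /=.
rewrite /Num.norm /= ge_max; apply/andP; split.
  apply: le_trans (ltW M1); rewrite stateE normrZ.
  have /andP[s0 s1] := s01.
  by rewrite ger0_norm // ler_piMl.
rewrite ger0_norm ?ltW //; apply: le_lt_trans M2.
by apply: le_trans (Thi _ _ s01 v0 Tx) _; apply: hc; rewrite in_itv.
Qed.

(** The conditions on [h] are those under which the region [h >= 0] is bounded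
and all of its exterior is connected to infinity within the strip. *)
Lemma plane_enclosed (h : R -> R -> R) (hi : R -> R) (c : R) :
  continuous (fun x : 'rV[R]_2 * R => h (param x.1) x.2) -> continuous hi ->
  0 < c ->
  (forall s v, 0 <= s <= 1 -> 0 < v -> 0 <= h s v -> v <= hi s) ->
  (forall v, 0 < v -> h 0 v < 0) ->
  (forall s v, 0 <= s <= 1 -> 0 < v <= c -> h s v < 0) ->
  (forall s v, 0 <= s <= 1 -> 0 < v -> h s v < 0 ->
    (forall t, v <= t -> h s t < 0) \/ (forall t, 0 < t <= v -> h s t < 0)) ->
  enclosed_region plane (plane `&` [set x | h (param x.1) x.2 = 0]) =
  plane `&` [set x | 0 <= h (param x.1) x.2].
Proof.
move=> ch chi c0 hhi hleft hlow hud; apply: enclosed_region_superlevel => //.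
  apply: (bounded_under_graph chi) => s v s01 v0 /=.
  by rewrite paramK //; exact: hhi.
move=> x /planeP[s [v [s01 v0 ->]]]; rewrite paramK //= => hsv.
set N := _ `&` _.
have NE s' v' : 0 <= s' <= 1 -> 0 < v' -> h s' v' < 0 -> N (st s', v').
  move=> s'01 v'0 hs; split; first by apply/planeP; exists s', v'.
  by rewrite /= paramK.
apply: (@unbounded_component R _ (fun s v => (st s, v)) plane N c) => //.
- by move=> s'; apply: (@lift_continuous (fun=> s') id) => ?;
    [exact: cvg_cst|exact: cvg_id].
- by move=> v'; apply: (@lift_continuous id (fun=> v')) => ?;
    [exact: cvg_id|exact: cvg_cst].
- by move=> s' v' _; exact: lift_norm.
- by move=> v' v'0; apply: NE; rewrite ?lexx ?ler01 //; exact: hleft.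
- by move=> s' v' s'01 v'c; apply: NE; [|case/andP: v'c|exact: hlow].
- exact: NE.
- case: (hud _ _ s01 v0 hsv) => H; [left|right] => t ht; apply: NE => //.
  + exact: lt_le_trans ht.
  + exact: H.
  + by case/andP: ht.
  + exact: H.
Qed.

(** * The surface in left states *)

(** The surface in left-state coordinates (s, v), with the right state
eliminated. *)
Definition region_minus s v : Prop :=
  [/\ 0 <= s <= 1, sg s 1 <= v, la s <= v & v <= lb s].

Lemma sigma1_0 : sg 0 1 = 1.
Proof. by rewrite /sigma /Eden; field; rewrite gt_eqF. Qed.

Lemma lam_b_0 : lb 0 = 0.
Proof. by rewrite /lam_b mulr0 !mul0r. Qed.

Lemma region_minus_param s v : region_minus s v -> 0 < s <= u.
Proof.
move=> [/andP[s0 s1] h1v lav vlb]; have sp : 0 < s.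
  rewrite lt_neqAle s0 andbT; apply/eqP => e; move: h1v vlb.
  rewrite -e sigma1_0 lam_b_0 => a b.
  by have := le_trans a b; rewrite ler10.
by rewrite sp -(lam_a_le_lam_b nu0 sp) (le_trans lav).
Qed.

Lemma sigma_le_lam_b_fF s m : 0 <= s <= u -> 2^-1 <= m <= 1 ->
  (sg s m <= lb s) = (F m <= s).
Proof.
move=> /andP[s0 su] m01; have /andP[m0 m1] := m01.
have s1 : 0 <= s < 1 by rewrite s0 (le_lt_trans su) // (le_lt_trans umb_half).
rewrite -tang_ge0 //.
have [sm|ms] := ltP s m; first by rewrite sigma_le_lam_b.
have m_half : m = 2^-1.
  by apply/le_anti; rewrite m0 (le_trans ms) // (le_trans su).
have su' : s = u.
  by apply/le_anti; rewrite su (le_trans umb_half) // -m_half.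
rewrite tang_ge0 // su' m_half sigma_umb_half // lam_b_umb //.
by rewrite (umb_params nu0 nu1).1 !lexx.
Qed.

(** As m runs from 1/2 to 1, the speed [sigma s m] goes from a value not below
[lam_b s] to [sigma s 1], so it takes every value v of the region. Conversely
[sigma s 1] is the least speed over all m. *)
Lemma region_minusP s v : region_minus s v <->
  exists2 m, 2^-1 <= m <= 1 & F m <= s <= S m /\ v = sg s m.
Proof.
split=> [rsv|[m m01 [/andP[Fs sS] ->]]]; last first.
  have /andP[m0 m1] := m01.
  have s0 : 0 <= s by apply: le_trans Fs; rewrite ltW // fF_gt0.
  have su : s <= u by apply: le_trans sS _; exact: fS_le_umb.
  have s1 : s <= 1 by rewrite (le_trans su) // (le_trans umb_half) // ltW.
  split; first by rewrite s0.
  - by apply: sigma1_le_sigma => //; rewrite s0.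
  - by rewrite lam_a_le_sigma.
  - by rewrite sigma_le_lam_b_fF // s0.
have /andP[s0 su] := region_minus_param rsv; have [s01 h1v lav vlb] := rsv.
have hlb := lam_b_le_sigma_half nu0 nu1 su.
have cs : continuous (fun m => sg s m).
  by apply: sigma_continuous => // m; [exact: cvg_cst|exact: cvg_id].
have [|m m01 mv] := @IVT R (fun m => sg s m) 2^-1 1 v (ltW half_lt1)
    (continuous_subspaceT cs).
  by rewrite ge_min le_max h1v orbT (le_trans vlb).
rewrite in_itv /= in m01; exists m => //; split => //.
rewrite -sigma_le_lam_b_fF ?(ltW s0) //.
by rewrite -(lam_a_le_sigma nu0) mv vlb.
Qed.

Lemma TminusE : Tminus muw muo mug 2^-1 =
  plane `&` [set x | region_minus (param x.1) x.2].
Proof.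
apply/seteqP; split=> x.
- move=> [m /=]; rewrite in_itv /= => m01; rewrite /Cminus calFE // frakSE //.
  move=> [s /=]; rewrite in_itv /= => sFS <-.
  have rs : region_minus s (sg s m) by apply/region_minusP; exists m.
  have [s01 _ lav _] := rs; have /andP[s0 _] := region_minus_param rs.
  split; last by rewrite /= paramK.
  apply/planeP; exists s, (sg s m); split => //.
  by apply: lt_le_trans lav; rewrite divr_gt0 // mulr_gt0.
- move=> [/planeP[s [v [s01 v0 ->]]]]; rewrite /= paramK //.
  move=> /region_minusP[m m01 [sFS vE]]; exists m; first by rewrite /= in_itv.
  rewrite /Cminus calFE // frakSE //; exists s; first by rewrite /= in_itv.
  by rewrite vE.
Qed.

Lemma SCBminusE : SCBminus muw muo mug 2^-1 =
  [set (st (S m), sg (S m) m) | m in `[2^-1, 1]].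
Proof.
have [a b] := SCB_dom_sandwich.
rewrite /SCBminus (eq_imagel (f' := fun m => (st (S m), sg (S m) m))).
  apply: closure_image_itv => //.
  apply: lift_continuous; first exact: fS_continuous.
  by apply: sigma_continuous => // [|m]; [exact: fS_continuous|exact: cvg_id].
by move=> m /b /=; rewrite in_itv /= => m01; rewrite frakSE.
Qed.

Lemma UCBminusE : UCBminus muw muo mug 2^-1 =
  [set (st (F m), sg (F m) m) | m in `[2^-1, 1]].
Proof.
have [a b] := UCB_dom_sandwich.
rewrite /UCBminus (eq_imagel (f' := fun m => (st (F m), sg (F m) m))).
  apply: closure_image_itv => //.
  apply: lift_continuous; first exact: fF_continuous.
  by apply: sigma_continuous => // [|m]; [exact: fF_continuous|exact: cvg_id].
by move=> m /b /=; rewrite in_itv /= => m01; rewrite calFE.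
Qed.

Lemma GUBminusE : GUBminus muw muo mug =
  [set (st s, sg s 1) | s in `[F 1, S 1]].
Proof.
rewrite /GUBminus /GUB_dom calFE // frakSE //.
apply: closure_image_itv => //; last by apply: subset_itvW; rewrite ?lexx.
apply: lift_continuous; first by move=> m; exact: cvg_id.
by apply: sigma_continuous => // m; [exact: cvg_id|exact: cvg_cst].
Qed.

Let min_eq0 (a b : R) : Num.min a b = 0 <->
  [/\ 0 <= a, 0 <= b & a = 0 \/ b = 0].
Proof.
split=> [e|[a0 b0 [e|e]]].
- have : 0 <= Num.min a b by rewrite e.
  rewrite le_min => /andP[a0 b0]; split => //.
  by move: e; rewrite /Num.min; case: ifP => _ ->; [left|right].
- by rewrite e min_l.
- by rewrite e min_r.
Qed.

Lemma region_minus_plane s v : region_minus s v -> plane (st s, v).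
Proof.
move=> rs; have [s01 _ lav _] := rs.
have /andP[s0 _] := region_minus_param rs.
apply/planeP; exists s, v; split => //.
by apply: lt_le_trans lav; rewrite divr_gt0 // mulr_gt0.
Qed.

(** On the region each of the three curves is equality in one inequality; the
right state m is recovered from (s, v) by [region_minusP]. *)
Lemma SCBminusP (x : 'rV[R]_2 * R) : SCBminus muw muo mug 2^-1 x <->
  exists s v, [/\ region_minus s v, v = la s & x = (st s, v)].
Proof.
rewrite SCBminusE //; split=> [[m /=]|[s [v [rs ve ->]]]].
  rewrite in_itv /= => m01 <-; exists (S m), (sg (S m) m); split => //.
    apply/region_minusP; exists m => //.
    by rewrite fF_le_fS // lexx.
  by apply/eqP; rewrite lam_a_eq_sigma.
have /region_minusP[m m01 [_ vm]] := rs.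
exists m; first by rewrite /= in_itv.
have -> : S m = s by apply/esym/eqP; rewrite -lam_a_eq_sigma // -vm ve.
by rewrite -vm.
Qed.

Lemma UCBminusP (x : 'rV[R]_2 * R) : UCBminus muw muo mug 2^-1 x <->
  exists s v, [/\ region_minus s v, v = lb s & x = (st s, v)].
Proof.
rewrite UCBminusE //; split=> [[m /=]|[s [v [rs ve ->]]]].
  rewrite in_itv /= => m01 <-; exists (F m), (sg (F m) m); split => //.
    apply/region_minusP; exists m => //.
    by rewrite fF_le_fS // lexx.
  apply/sigma_eq_lam_b => //.
  by rewrite ltW ?fF_gt0 ?fF_le_umb //; case/andP: m01.
have /region_minusP[m m01 [_ vm]] := rs.
have /andP[s0 su] := region_minus_param rs.
exists m; first by rewrite /= in_itv.
have -> : F m = s.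
  apply/esym/sigma_eq_lam_b => //; first by rewrite ltW.
  by rewrite -vm.
by rewrite -vm.
Qed.

Lemma GUBminusP (x : 'rV[R]_2 * R) : GUBminus muw muo mug x <->
  exists s v, [/\ region_minus s v, v = sg s 1 & x = (st s, v)].
Proof.
rewrite GUBminusE //; split=> [[s /=]|[s [v [rs ve ->]]]].
  rewrite in_itv /= => FsS <-; exists s, (sg s 1); split => //.
  by apply/region_minusP; exists 1.
have [_ _ lav vlb] := rs.
have /andP[s0 su] := region_minus_param rs.
exists s; last by rewrite ve.
rewrite /= in_itv /= -(lam_a_le_sigma nu0) -sigma_le_lam_b_fF ?(ltW s0) //.
by rewrite -ve vlb.
Qed.

(** The least slack in the inequalities of [region_minus]: its zero set is the
union of the three curves. *)
Definition height_minus s v : R :=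
  Num.min (Num.min (v - sg s 1) (v - la s)) (lb s - v).

Let height_minus_ge0 s v : 0 <= s <= 1 ->
  0 <= height_minus s v <-> region_minus s v.
Proof.
move=> s01; rewrite /height_minus !le_min !subr_ge0.
by split=> [/andP[/andP[? ?] ?]|[_ -> -> ->]].
Qed.

Let height_minus_eq0 s v : 0 <= s <= 1 -> height_minus s v = 0 <->
  region_minus s v /\ [\/ v = la s, v = lb s | v = sg s 1].
Proof.
move=> s01; split=> [e|[/(height_minus_ge0 _ s01)]].
  have rs : region_minus s v by apply/(height_minus_ge0 _ s01); rewrite e.
  split => //; move: e => /min_eq0[_ _ []]; last first.
    by move=> /eqP; rewrite subr_eq0 => /eqP ->; constructor 2.
  by move=> /min_eq0[_ _ []] /eqP; rewrite subr_eq0 => /eqP ->;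
    [constructor 3|constructor 1].
rewrite /height_minus !le_min => /andP[/andP[a1 a2] b] H.
apply/min_eq0; split => //; first by rewrite le_min a1.
case: H => e.
- by left; apply/min_eq0; split => //; right; rewrite e subrr.
- by right; rewrite e subrr.
- by left; apply/min_eq0; split => //; left; rewrite e subrr.
Qed.

Lemma Eden_le1 s : 0 <= s <= 1 -> E s <= 1.
Proof.
move=> /andP[s0 s1]; rewrite /Eden.
have : nu * (1 - s) ^+ 2 <= 1 * (1 - s) ^+ 2 by rewrite ler_wpM2r ?sqr_ge0.
nra.
Qed.

Lemma lam_a_ge s : 0 <= s <= 1 -> 2 * s <= la s.
Proof.
move=> s01; have /andP[s0 _] := s01.
by rewrite /lam_a ler_pdivlMr // ler_piMr ?mulr_ge0 // Eden_le1.
Qed.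

Lemma sigma1_ge s : 0 <= s <= 1 -> nu * (1 - s) <= sg s 1.
Proof.
move=> s01; have /andP[s0 s1] := s01.
have E1 : E 1 = 1 by rewrite /Eden; ring.
rewrite /sigma E1 !mulr1 ler_pdivlMr //.
have -> : nu * (s + 1 - 2 * s) = nu * (1 - s) by ring.
apply: ler_piMr; last exact: Eden_le1.
by apply: mulr_ge0; [exact: ltW|rewrite subr_ge0].
Qed.

Lemma height_minus_continuous :
  continuous (fun x : 'rV[R]_2 * R => height_minus (param x.1) x.2).
Proof.
have cv := speed_coordinate_continuous.
have cs1 : continuous (fun s => sg s 1).
  by apply: sigma_continuous => // m; [exact: cvg_id|exact: cvg_cst].
apply: (@continuous_minr _ _ (fun x => Num.min _ _) (fun x => _ - _)).
  apply: (@continuous_minr _ _ (fun x => _ - _) (fun x => _ - _)).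
    by apply: continuous_subr => //; exact: (param_comp_continuous cs1).
  apply: continuous_subr => //; exact: (param_comp_continuous lam_a_continuous).
apply: continuous_subr => //; exact: (param_comp_continuous lam_b_continuous).
Qed.

Let hatD1E : hatD1 muw muo mug = (st (S 1), sg (S 1) 1).
Proof. by rewrite /hatD1 fS1. Qed.

Let hatD2E : hatD2 muw muo mug = (st (F 1), sg (F 1) 1).
Proof. by rewrite /hatD2 fF1. Qed.

Lemma boundary_minusE : SCBminus muw muo mug 2^-1 `|`
    UCBminus muw muo mug 2^-1 `|` GUBminus muw muo mug =
  plane `&` [set x | height_minus (param x.1) x.2 = 0].
Proof.
apply/seteqP; split=> x.
- have H s v : region_minus s v -> [\/ v = la s, v = lb s | v = sg s 1] ->
      (plane `&` [set x | height_minus (param x.1) x.2 = 0]) (st s, v).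
    move=> rs vs; split; first exact: region_minus_plane.
    by rewrite /= paramK //; apply/height_minus_eq0; case: (rs).
  move=> [[/SCBminusP|/UCBminusP]|/GUBminusP] [s [v [rs ve ->]]];
    apply: H => //.
  + by constructor 1.
  + by constructor 2.
  + by constructor 3.
- move=> [/planeP[s [v [s01 v0 ->]]]]; rewrite /= paramK //.
  move=> /height_minus_eq0.
  move=> /(_ s01)[rs [] ve]; [left; left|left; right|right].
  + by apply/SCBminusP; exists s, v.
  + by apply/UCBminusP; exists s, v.
  + by apply/GUBminusP; exists s, v.
Qed.

Lemma Tminus_enclosed : Tminus muw muo mug 2^-1 =
  enclosed_region plane (SCBminus muw muo mug 2^-1 `|`
    UCBminus muw muo mug 2^-1 `|` GUBminus muw muo mug).
Proof.
(* For small speeds one of the lower bounds fails: up to s = 1/2 the speed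
[sigma s 1] is at least nu / 2, and after it [lam_a s] is at least 1. *)
have nu8 : 0 < nu / 8 by rewrite divr_gt0.
rewrite boundary_minusE (plane_enclosed height_minus_continuous
  lam_b_continuous nu8).
- rewrite TminusE; apply/seteqP; split=> x [px].
    move: (px) => /planeP[s [v [s01 v0 xE]]]; subst x.
    rewrite /= paramK // => rs.
    by split; [exact: px|exact/(height_minus_ge0 _ s01)].
  move: (px) => /planeP[s [v [s01 v0 xE]]]; subst x.
  rewrite /= paramK // => rs.
  by split; [exact: px|exact/(height_minus_ge0 _ s01)].
- by move=> s v s01 _ /(height_minus_ge0 _ s01)[].
- move=> v v0; rewrite /height_minus gt_min lam_b_0 sub0r oppr_lt0 v0.
  by rewrite orbT.
- move=> s v s01 /andP[v0 vc]; rewrite /height_minus !gt_min !subr_lt0.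
  have := sigma1_ge s01; have := lam_a_ge s01; have := nu0; have := nu1.
  move=> n1 n0 las sgs; apply/orP; left; apply/orP.
  have [sh|sh] := leP s 2^-1; [left; nra|right; lra].
- move=> s v s01 v0; have [bv _|vb] := ltP (lb s) v.
    left=> t vt; rewrite /height_minus gt_min subr_lt0 (lt_le_trans bv vt).
    by rewrite orbT.
  move=> H; right=> t /andP[t0 tv]; move: H; rewrite /height_minus.
  rewrite !gt_min !subr_lt0 (ltNge (lb s) v) vb orbF.
  by case/orP => H; rewrite (le_lt_trans tv H) ?orbT.
Qed.

Lemma region_minus_bounded : region_bounded_by plane
  (SCBminus muw muo mug 2^-1) (UCBminus muw muo mug 2^-1)
  (GUBminus muw muo mug) (hatD1 muw muo mug) (hatD2 muw muo mug)
  (hatU muw muo mug) (Tminus muw muo mug 2^-1).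
Proof.
have UE : hatU muw muo mug = (st u, 2) by rewrite /hatU umbilicE.
split; rewrite ?hatD1E ?hatD2E ?UE.
- apply/seteqP; split=> [x [/SCBminusP[s [v [rs ve ->]]]]|_ ->]; last first.
    have hh : `[2^-1, 1]%classic (2^-1 : R) by rewrite /= in_itv.
    have [Fh Sh] := umb_params nu0 nu1.
    split.
      by rewrite SCBminusE //; exists 2^-1; rewrite // Sh sigma_umb_half.
    by rewrite UCBminusE //; exists 2^-1; rewrite // Fh sigma_umb_half.
  move=> /UCBminusP[t [w [_ we /lifted_inj[e1 e2]]]].
  have /andP[s0 _] := region_minus_param rs.
  have := lam_b_sub_lam_a nu0 s; rewrite -ve e1 -we -e2 subrr => /esym/eqP.
  rewrite -e1 mulf_eq0 invr_eq0 expf_eq0 (negbTE (En _)) andbF orbF.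
  rewrite mulf_eq0 (gt_eqF (_ : 0 < 2 * s ^+ 2)) ?mulr_gt0 ?exprn_gt0 //=.
  rewrite subr_eq0 => /eqP nus; have su : s = u.
    by apply: (canRL (mulfK (lt0r_neq0 onenu_gt0))); rewrite mulrC -nus.
  by rewrite ve su lam_a_umb.
- apply/seteqP; split=> [x [/SCBminusP[s [v [rs ve ->]]]]|_ ->]; last first.
    split.
      by rewrite SCBminusE //; exists 1; rewrite //= in_itv.
    rewrite GUBminusE //; exists (S 1); rewrite //= in_itv /=.
    by rewrite lexx (ltW F1S1).
  move=> /GUBminusP[t [w [_ we /lifted_inj[e1 e2]]]].
  have se : s = S 1.
    by apply/eqP; rewrite -lam_a_eq_sigma // -ve e2 we e1.
  by rewrite -se e2 we -e1.
- apply/seteqP; split=> [x [/UCBminusP[s [v [rs ve ->]]]]|_ ->]; last first.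
    split.
      by rewrite UCBminusE //; exists 1; rewrite //= in_itv.
    rewrite GUBminusE //; exists (F 1); rewrite //= in_itv /=.
    by rewrite lexx (ltW F1S1).
  move=> /GUBminusP[t [w [_ we /lifted_inj[e1 e2]]]].
  have /andP[s0 su] := region_minus_param rs.
  have se : s = F 1.
    apply/sigma_eq_lam_b => //; first by rewrite ltW.
    by rewrite -ve e2 we e1.
  by rewrite -se e2 we -e1.
- by rewrite boundary_minusE => x [].
- exact: Tminus_enclosed.
Qed.

Lemma subset_Tminus :
  [/\ SCBminus muw muo mug 2^-1 `<=` Tminus muw muo mug 2^-1,
  UCBminus muw muo mug 2^-1 `<=` Tminus muw muo mug 2^-1 &
  GUBminus muw muo mug `<=` Tminus muw muo mug 2^-1].
Proof.
rewrite Tminus_enclosed.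
by split=> x H; left; [left; left|left; right|right].
Qed.

Lemma arcs_minus :
  [/\ simple_arc R (SCBminus muw muo mug 2^-1) (hatD1 muw muo mug)
        (hatU muw muo mug),
      simple_arc R (UCBminus muw muo mug 2^-1) (hatD2 muw muo mug)
        (hatU muw muo mug) &
      simple_arc R (GUBminus muw muo mug) (hatD2 muw muo mug)
        (hatD1 muw muo mug)].
Proof.
have [Fh Sh] := umb_params nu0 nu1.
have UE : hatU muw muo mug = (st u, sg u 2^-1).
  by rewrite /hatU umbilicE // sigma_umb_half.
have cid : continuous (fun m : R => m) by move=> m; exact: cvg_id.
have c1 : continuous (fun m : R => 1 : R) by move=> m; exact: cvg_cst.
have cS := fS_continuous; have cF := fF_continuous.
split; rewrite ?hatD1E ?hatD2E ?UE.
- rewrite SCBminusE // -[in X in simple_arc _ _ _ X]Sh.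
  apply: (simple_arc_image half_lt1
    (g := fun m => (st (S m), sg (S m) m)) _ _).2.
    by apply: lift_continuous => //; exact: sigma_continuous.
  move=> m n; rewrite !inE /= => mi ni /lifted_inj[e _].
  exact: (fS_inj nu0 nu1 mi ni).
- rewrite UCBminusE // -[in X in simple_arc _ _ _ X]Fh.
  apply: (simple_arc_image half_lt1
    (g := fun m => (st (F m), sg (F m) m)) _ _).2.
    by apply: lift_continuous => //; exact: sigma_continuous.
  move=> m n; rewrite !inE /= => mi ni /lifted_inj[e _].
  exact: (fF_inj nu0 nu1 mi ni).
- rewrite GUBminusE //.
  apply: (simple_arc_image F1S1 (g := fun s => (st s, sg s 1)) _ _).1.
    by apply: lift_continuous => //; exact: sigma_continuous.
  by move=> m n _ _ /lifted_inj[].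
Qed.

(** * The surface in right states *)

Definition speedS m : R := sg (S m) m.
Definition speedF m : R := sg (F m) m.

Lemma speed_half : speedS 2^-1 = 2 /\ speedF 2^-1 = 2.
Proof.
have [Fh Sh] := umb_params nu0 nu1.
by rewrite /speedS /speedF Fh Sh sigma_umb_half.
Qed.

Lemma sigma_lt l s m : 2^-1 <= m <= 1 -> F m <= l -> l < s -> s < m ->
  sg s m < sg l m.
Proof.
move=> m01 Fl ls sm; have /andP[m0 m1] := m01.
have l0 : 0 <= l by apply: le_trans Fl; rewrite ltW // fF_gt0.
apply: sigma_decr => //; rewrite tang_ge0 // l0.
by rewrite (lt_trans ls) // (lt_le_trans sm).
Qed.

Lemma speed_lt m : 2^-1 < m <= 1 -> speedS m < speedF m.
Proof.
move=> m01; have /andP[m0 m1] := m01.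
apply: sigma_lt => //; first by rewrite ltW.
  exact: fF_lt_fS.
by apply: le_lt_trans (fS_le_umb nu0 nu1 (ltW m0)) (le_lt_trans umb_half m0).
Qed.

Lemma speed_le m : 2^-1 <= m <= 1 -> speedS m <= speedF m.
Proof.
move=> /andP[]; rewrite le_eqVlt => /predU1P[<-|m0] m1.
  by rewrite speed_half.1 speed_half.2.
by rewrite ltW // speed_lt // m0.
Qed.

(** A uniform positive lower bound: speeds below it are outside the region for
every right state, which lets the exterior be connected along the bottom. *)
Lemma speedS_ge m : 2^-1 <= m <= 1 -> nu / 4 <= speedS m.
Proof.
move=> /andP[m0 m1].
have -> : speedS m = la (S m) by apply/eqP; rewrite lam_a_eq_sigma.
have S0 : 0 < S m by rewrite fS_gt0 // (lt_le_trans half_gt0).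
have S1 : S m < 1 by exact: fS_lt1.
apply: le_trans (lam_a_ge _); last by rewrite !ltW.
suff : nu / 8 <= S m by lra.
rewrite /fS ler_pdivlMr ?denS_gt0 //.
have : nu * denS muw muo mug m <= nu * (8 * m).
  rewrite ler_pM2l // /denS.
  have := nu0; have := nu1; nra.
lra.
Qed.

Lemma speedS_continuous : continuous speedS.
Proof.
by apply: sigma_continuous => // [|m]; [exact: fS_continuous|exact: cvg_id].
Qed.

Lemma speedF_continuous : continuous speedF.
Proof.
by apply: sigma_continuous => // [|m]; [exact: fF_continuous|exact: cvg_id].
Qed.

Definition region_plus m v : Prop :=
  2^-1 <= m <= 1 /\ speedS m <= v <= speedF m.

Lemma region_plus_plane m v : region_plus m v -> plane (st m, v).
Proof.
move=> [m01 /andP[Sv _]]; have /andP[m0 m1] := m01.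
apply/planeP; exists m, v; split => //.
  by rewrite m1 (le_trans (ltW half_gt0)).
apply: lt_le_trans Sv; apply: lt_le_trans (speedS_ge m01).
by rewrite divr_gt0.
Qed.

Lemma TplusE : Tplus muw muo mug 2^-1 =
  plane `&` [set x | region_plus (param x.1) x.2].
Proof.
apply/seteqP; split=> x.
- move=> [m /=]; rewrite in_itv /= => m01; rewrite /Cplus calFE // frakSE //.
  move=> [v /=]; rewrite in_itv /= => vSF <-.
  have rp : region_plus m v by [].
  by split; [exact: region_plus_plane|rewrite /= paramK].
- move=> [/planeP[m [v [s01 v0 ->]]]]; rewrite /= paramK //.
  move=> [m01 vSF]; exists m; first by rewrite /= in_itv.
  by rewrite /Cplus calFE // frakSE //; exists v; rewrite //= in_itv.
Qed.

Lemma SCBplusE : SCBplus muw muo mug 2^-1 =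
  [set (st m, sg (S m) m) | m in `[2^-1, 1]].
Proof.
have [a b] := SCB_dom_sandwich.
rewrite /SCBplus (eq_imagel (f' := fun m => (st m, sg (S m) m))).
  apply: closure_image_itv => //; apply: lift_continuous.
    by move=> m; exact: cvg_id.
  by apply: sigma_continuous => // [|m]; [exact: fS_continuous|exact: cvg_id].
by move=> m /b /=; rewrite in_itv /= => m01; rewrite frakSE.
Qed.

Lemma UCBplusE : UCBplus muw muo mug 2^-1 =
  [set (st m, sg (F m) m) | m in `[2^-1, 1]].
Proof.
have [a b] := UCB_dom_sandwich.
rewrite /UCBplus (eq_imagel (f' := fun m => (st m, sg (F m) m))).
  apply: closure_image_itv => //; apply: lift_continuous.
    by move=> m; exact: cvg_id.
  by apply: sigma_continuous => // [|m]; [exact: fF_continuous|exact: cvg_id].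
by move=> m /b /=; rewrite in_itv /= => m01; rewrite calFE.
Qed.

Lemma GUBplusE : GUBplus muw muo mug =
  [set (st 1, sg s 1) | s in `[F 1, S 1]].
Proof.
rewrite /GUBplus /GUB_dom calFE // frakSE //.
apply: closure_image_itv => //; last by apply: subset_itvW; rewrite ?lexx.
apply: lift_continuous; first by move=> m; exact: cvg_cst.
by apply: sigma_continuous => // m; [exact: cvg_id|exact: cvg_cst].
Qed.

Lemma SCBplusP (x : 'rV[R]_2 * R) : SCBplus muw muo mug 2^-1 x <->
  exists2 m, 2^-1 <= m <= 1 & x = (st m, speedS m).
Proof.
rewrite SCBplusE //; split=> [[m /=]|[m m01 ->]].
  by rewrite in_itv /= => m01 <-; exists m.
by exists m; rewrite //= in_itv.
Qed.

Lemma UCBplusP (x : 'rV[R]_2 * R) : UCBplus muw muo mug 2^-1 x <->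
  exists2 m, 2^-1 <= m <= 1 & x = (st m, speedF m).
Proof.
rewrite UCBplusE //; split=> [[m /=]|[m m01 ->]].
  by rewrite in_itv /= => m01 <-; exists m.
by exists m; rewrite //= in_itv.
Qed.

(** The speed to D decreases from [speedF 1] to [speedS 1] as the left state
moves from F(D) to S(D), and takes all values in between. *)
Lemma GUBplusP (x : 'rV[R]_2 * R) : GUBplus muw muo mug x <->
  exists2 v, speedS 1 <= v <= speedF 1 & x = (st 1, v).
Proof.
rewrite GUBplusE //; split=> [[s /=]|[v vSF ->]].
  rewrite in_itv /= => /andP[Fs sS] <-; exists (sg s 1) => //.
  have s1 := le_lt_trans sS S1_lt1; apply/andP; split.
    move: sS; rewrite le_eqVlt => /predU1P[->|sS]; first by [].
    by apply: ltW; exact: sigma_lt.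
  move: Fs; rewrite le_eqVlt => /predU1P[<-|Fs]; first by [].
  by apply: ltW; exact: sigma_lt.
have cs : continuous (fun s => sg s 1).
  by apply: sigma_continuous => // m; [exact: cvg_id|exact: cvg_cst].
have [|s s01 <-] := @IVT R (fun s => sg s 1) (F 1) (S 1) v (ltW F1S1)
    (continuous_subspaceT cs).
  by rewrite ge_min le_max; case/andP: vSF => /= -> ->; rewrite !orbT.
by exists s.
Qed.

Definition height_plus m v : R :=
  Num.min (Num.min (m - 2^-1) (1 - m)) (Num.min (v - speedS m) (speedF m - v)).

Let height_plus_ge0 m v : 0 <= height_plus m v <-> region_plus m v.
Proof.
rewrite /height_plus !le_min !subr_ge0 /region_plus.
by split=> [/andP[-> ->]|[-> ->]].
Qed.

Lemma height_plus_continuous :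
  continuous (fun x : 'rV[R]_2 * R => height_plus (param x.1) x.2).
Proof.
have cv := speed_coordinate_continuous.
have cp : continuous (fun x : 'rV[R]_2 * R => param x.1).
  by apply: (@param_comp_continuous id) => m; exact: cvg_id.
have cc (a : R) : continuous (fun x : 'rV[R]_2 * R => a).
  by move=> x; exact: cvg_cst.
apply: (@continuous_minr _ _ (fun x => Num.min _ _) (fun x => Num.min _ _)).
  by apply: (@continuous_minr _ _ (fun x => _ - _) (fun x => _ - _));
    exact: continuous_subr.
apply: (@continuous_minr _ _ (fun x => _ - _) (fun x => _ - _));
  apply: continuous_subr => //.
  exact: (param_comp_continuous speedS_continuous).
exact: (param_comp_continuous speedF_continuous).
Qed.

Let hatDE : hatD muw muo mug = (st 1, speedS 1).
Proof. by rewrite /hatD /speedS fS1. Qed.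

Let checkDE : checkD muw muo mug = (st 1, speedF 1).
Proof. by rewrite /checkD /speedF fF1. Qed.

Lemma boundary_plusE : SCBplus muw muo mug 2^-1 `|`
    UCBplus muw muo mug 2^-1 `|` GUBplus muw muo mug =
  plane `&` [set x | height_plus (param x.1) x.2 = 0].
Proof.
apply/seteqP; split=> x.
- have H m v : region_plus m v -> [\/ v = speedS m, v = speedF m | m = 1] ->
      (plane `&` [set x | height_plus (param x.1) x.2 = 0]) (st m, v).
    move=> rp vs; split; first exact: region_plus_plane.
    rewrite /= paramK //; move/height_plus_ge0: rp; rewrite /height_plus.
    rewrite le_min => /andP[a b]; apply/min_eq0; split => //.
    move: a b; rewrite !le_min => /andP[a1 a2] /andP[b1 b2].
    case: vs => e; [right|right|left]; apply/min_eq0; split => //.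
    + by left; rewrite e subrr.
    + by right; rewrite e subrr.
    + by right; rewrite e subrr.
  move=> [[/SCBplusP|/UCBplusP]|/GUBplusP] [m m01 ->]; apply: H.
  + by split; rewrite // lexx speed_le.
  + by constructor 1.
  + by split; rewrite // lexx speed_le.
  + by constructor 2.
  + by [].
  + by constructor 3.
- move=> [/planeP[m [v [_ v0 ->]]]]; rewrite /= paramK // => e.
  have [m01 vSF] : region_plus m v by apply/height_plus_ge0; rewrite e.
  have sub0 (a b : R) : a - b = 0 -> a = b.
    by move/eqP; rewrite subr_eq0 => /eqP.
  case: (e) => /min_eq0[_ _ [|]] /min_eq0[_ _ [|]] /sub0 h.
  (* Over m = 1/2 the region is the single point where SCB and UCB meet. *)
  + left; left; apply/SCBplusP; exists m => //; congr (_, _).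
    by move: vSF; rewrite h speed_half.1 speed_half.2 => /le_anti.
  + right; apply/GUBplusP; exists v; first by rewrite h.
    by rewrite h.
  + by left; left; apply/SCBplusP; exists m; rewrite // h.
  + by left; right; apply/UCBplusP; exists m; rewrite // h.
Qed.

Lemma Tplus_enclosed : Tplus muw muo mug 2^-1 =
  enclosed_region plane (SCBplus muw muo mug 2^-1 `|`
    UCBplus muw muo mug 2^-1 `|` GUBplus muw muo mug).
Proof.
have nu8 : 0 < nu / 8 by rewrite divr_gt0.
rewrite boundary_plusE (plane_enclosed height_plus_continuous
  speedF_continuous nu8).
- rewrite TplusE; apply/seteqP; split=> x [px].
    by move=> /height_plus_ge0 rp; split.
  by move=> /height_plus_ge0 rp; split.
- by move=> m v _ _ /height_plus_ge0[_ /andP[]].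
- move=> v v0; rewrite /height_plus !gt_min sub0r oppr_lt0.
  by rewrite half_gt0.
- move=> m v /andP[m0 m1] /andP[v0 vc]; rewrite /height_plus !gt_min !subr_lt0.
  have [mh|mh] := ltP m 2^-1; first by [].
  rewrite (_ : v < speedS m) ?orbT //.
  apply: le_lt_trans vc _; apply: lt_le_trans (speedS_ge _); last by rewrite mh.
  by have := nu0; lra.
- move=> m v /andP[m0 m1] v0; rewrite /height_plus.
  rewrite !gt_min !subr_lt0 (ltNge 1) m1 orbF => /or3P[mh|vS|Fv].
  + by left=> t _; rewrite !gt_min !subr_lt0 mh.
  + right=> t /andP[_ tv]; rewrite !gt_min !subr_lt0 (le_lt_trans tv vS).
    by rewrite orbT.
  + left=> t vt; rewrite !gt_min !subr_lt0 (lt_le_trans Fv vt).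
    by rewrite !orbT.
Qed.

Lemma region_plus_bounded : region_bounded_by plane
  (SCBplus muw muo mug 2^-1) (UCBplus muw muo mug 2^-1)
  (GUBplus muw muo mug) (hatD muw muo mug) (checkD muw muo mug)
  (hatD0 muw muo 2^-1) (Tplus muw muo mug 2^-1).
Proof.
have S1F1 : speedS 1 <= speedF 1 by exact: speed_le.
split; rewrite ?hatDE ?checkDE /hatD0.
- apply/seteqP; split=> [x [/SCBplusP[m m01 ->]]|_ ->]; last first.
    split; [apply/SCBplusP|apply/UCBplusP]; exists 2^-1 => //.
      by rewrite speed_half.1.
    by rewrite speed_half.2.
  move=> /UCBplusP[n n01 /lifted_inj[e1 e]].
  suff -> : m = 2^-1 by rewrite speed_half.1.
  have /andP[m0 m1] := m01; apply/le_anti; rewrite m0 andbT leNgt.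
  apply/negP => mh; have := @speed_lt m; rewrite mh m1 => /(_ isT).
  by rewrite e -e1 ltxx.
- apply/seteqP; split=> [x [/SCBplusP[m m01 ->]]|_ ->]; last first.
    split; first by apply/SCBplusP; exists 1.
    by apply/GUBplusP; exists (speedS 1); rewrite // lexx.
  by move=> /GUBplusP[v _ /lifted_inj[-> _]].
- apply/seteqP; split=> [x [/UCBplusP[m m01 ->]]|_ ->]; last first.
    split; first by apply/UCBplusP; exists 1.
    by apply/GUBplusP; exists (speedF 1); rewrite // lexx andbT.
  by move=> /GUBplusP[v _ /lifted_inj[-> _]].
- by rewrite boundary_plusE => x [].
- exact: Tplus_enclosed.
Qed.

Lemma subset_Tplus : [/\ SCBplus muw muo mug 2^-1 `<=` Tplus muw muo mug 2^-1,
  UCBplus muw muo mug 2^-1 `<=` Tplus muw muo mug 2^-1 &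
  GUBplus muw muo mug `<=` Tplus muw muo mug 2^-1].
Proof.
rewrite Tplus_enclosed.
by split=> x H; left; [left; left|left; right|right].
Qed.

Lemma arcs_plus :
  [/\ simple_arc R (SCBplus muw muo mug 2^-1) (hatD muw muo mug)
        (hatD0 muw muo 2^-1),
      simple_arc R (UCBplus muw muo mug 2^-1) (checkD muw muo mug)
        (hatD0 muw muo 2^-1) &
      simple_arc R (GUBplus muw muo mug) (checkD muw muo mug)
        (hatD muw muo mug)].
Proof.
have cid : continuous (fun m : R => m) by move=> m; exact: cvg_id.
have c1 : continuous (fun m : R => 1 : R) by move=> m; exact: cvg_cst.
have D0S : hatD0 muw muo 2^-1 = (st 2^-1, speedS 2^-1).
  by rewrite /hatD0 speed_half.1.
have D0F : hatD0 muw muo 2^-1 = (st 2^-1, speedF 2^-1).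
  by rewrite /hatD0 speed_half.2.
split; rewrite ?hatDE ?checkDE.
- rewrite SCBplusE // D0S.
  apply: (simple_arc_image half_lt1 (g := fun m => (st m, speedS m)) _ _).2.
    by apply: lift_continuous => //; exact: speedS_continuous.
  by move=> m n _ _ /lifted_inj[].
- rewrite UCBplusE // D0F.
  apply: (simple_arc_image half_lt1 (g := fun m => (st m, speedF m)) _ _).2.
    by apply: lift_continuous => //; exact: speedF_continuous.
  by move=> m n _ _ /lifted_inj[].
- rewrite GUBplusE //.
  apply: (simple_arc_image F1S1 (g := fun s => (st 1, sg s 1)) _ _).1.
    by apply: lift_continuous => //; exact: sigma_continuous.
  move=> s t; rewrite !inE /= !in_itv /= => /andP[Fs sS] /andP[Ft tS].
  move=> /lifted_inj[_ e]; case: (ltgtP s t) => // st'.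
    by have := sigma_lt one_in Fs st' (le_lt_trans tS S1_lt1); rewrite e ltxx.
  by have := sigma_lt one_in Ft st' (le_lt_trans sS S1_lt1); rewrite e ltxx.
Qed.

End Surface.

Unset Implicit Arguments.
Set Strict Implicit.
Set Printing Implicit Defensive.

Theorem lemma6p3 (R : realType) (muw muo mug : R)
    (hw : 0 < muw) (ho : 0 < muo) (hg : 0 < mug)
    (hnu : 0 < nuG muw muo mug <= 1)
    (sD0 : R)
    (hD0 : left_f_extension muw muo mug (sU muw muo mug) sD0) :
  let Tm := Tminus muw muo mug sD0 in
  let Tp := Tplus muw muo mug sD0 in
  let SCBm := SCBminus muw muo mug sD0 in
  let SCBp := SCBplus muw muo mug sD0 in
  let UCBm := UCBminus muw muo mug sD0 in
  let UCBp := UCBplus muw muo mug sD0 in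
  let GUBm := GUBminus muw muo mug in
  let GUBp := GUBplus muw muo mug in
  let Uh := hatU muw muo mug in
  let D0h := hatD0 muw muo sD0 in
  let D1h := hatD1 muw muo mug in
  let D2h := hatD2 muw muo mug in
  let Dh := hatD muw muo mug in
  let Dc := checkD muw muo mug in
  [/\ region_bounded_by (plane_GD muw muo) SCBm UCBm GUBm D1h D2h Uh Tm
      /\ region_bounded_by (plane_GD muw muo) SCBp UCBp GUBp Dh Dc D0h Tp,
      [/\ SCBm `<=` Tm, SCBp `<=` Tp,
          simple_arc R SCBm D1h Uh & simple_arc R SCBp Dh D0h],
      [/\ UCBm `<=` Tm, UCBp `<=` Tp,
          simple_arc R UCBm D2h Uh & simple_arc R UCBp Dc D0h] &
      [/\ GUBm `<=` Tm, GUBp `<=` Tp,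
          simple_arc R GUBm D2h D1h & simple_arc R GUBp Dc Dh]].
Proof.
have /andP[_ nu1] := hnu.
have -> : sD0 = 2^-1 by exact: (left_f_extension_umb hw ho hg nu1 hD0).
have [? ? ?] := subset_Tminus hw ho hg nu1.
have [? ? ?] := subset_Tplus hw ho hg nu1.
have [? ? ?] := arcs_minus hw ho hg nu1.
have [? ? ?] := arcs_plus hw ho hg nu1.
split; [split|by split..].
- exact: region_minus_bounded.
- exact: region_plus_bounded.
Qed.
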